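(* Let $n\ge 3$ and let $M^{n-1}$ be a non-CMC rotational hypersurface in $N^n(\rho)$. Then, locally, $M^{n-1}$ is biconservative if and only if its profile curve $\gamma(s)\subset N^2(\rho)$ satisfies the Euler-Lagrange equation associated to the curvature energy functional $$\mathbf{\Theta}_p(\gamma)=\int_\gamma\kappa^p,$$ where $p=(n-2)/(n+1)\in[1/4,1)$.
   Context: $N^n(\rho)$ is the $n$-dimensional Riemannian space form of constant sectional curvature $\rho$ ($\mathbb{R}^n$, $\mathbb{S}^n(\rho)$ or $\mathbb{H}^n(\rho)$ according to $\rho=0$, $\rho>0$, $\rho<0$). Hypersurfaces are immersed and oriented. With unit normal $\eta$, shape operator $S_\eta$ and mean curvature function $H=\mathrm{trace}\,S_\eta/(n-1)$, a hypersurface $M^{n-1}$ is biconservative if $2S_\eta(\mathrm{grad}\,H)+(n-1)H\,\mathrm{grad}\,H=0$. Non-CMC means that $H$ is not constant. A (spherical) rotational hypersurface is one invariant by the orthogonal group $O(n-1)$, considered as a subgroup of isometries of $N^n(\rho)$ whose orbits are $(n-2)$-dimensional spheres. It is the evolution under $O(n-1)$ of an arc length parametrized profile curve $\gamma(s)=(x_1(s),x_2(s),x_3(s))\subset N^2(\rho)\subset\mathbb{R}^3$; that is, $M^{n-1}$ consists of the points $(x_1(s)\,\phi,x_2(s),x_3(s))\in N^n(\rho)\subset\mathbb{R}^{n+1}$ with $\phi$ in the unit sphere of $\mathbb{R}^{n-1}$ (for $\rho<0$ the hyperboloid model is used, with the $x_1$-direction spacelike; for $\rho=0$, $N^n(0)$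 is an affine hyperplane $x_3=\text{const}$). $\kappa(s)$ is the signed curvature of $\gamma$ in $N^2(\rho)$; since $\kappa^p$ must be a smooth function of $\kappa$ on an adequate domain, the orientation of the normal of $\gamma$ is chosen so that $\kappa>0$. For an energy $\int_\gamma P(\kappa)$, the Euler-Lagrange equation (regardless of boundary conditions) is $\dot P_{ss}+\dot P(\kappa^2+\rho)-\kappa P=0$, where $\dot P=dP/d\kappa$ and the subscript $s$ denotes derivative with respect to arc length; for $P=\kappa^p$ it reads $(p\kappa^{p-1})_{ss}+p\kappa^{p-1}(\kappa^2+\rho)-\kappa^{p+1}=0$. ''Locally'' refers to portions of the hypersurface on which the curvature of the profile curve has no critical points, i.e. $\kappa'(s)\neq 0$.
   Formalization: The literal converse fails (translate a biconservative profile away from the axis when ρ=0), so it is stated up to an isometry of N²(ρ) moving the profile curve, and for ρ<0 it also assumes the first integral of the Euler-Lagrange equation is positive, which spherical orbits require. *)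

(* Defs.v *)
From HB Require Import structures.
From mathcomp Require Import all_boot all_order all_algebra.
From mathcomp Require Import all_classical all_reals all_analysis.
Set Implicit Arguments.
Unset Strict Implicit.
Unset Printing Implicit Defensive.
Import Order.TTheory GRing.Theory Num.Theory.
Import numFieldNormedType.Exports.
Local Open Scope classical_set_scope.
Local Open Scope ring_scope.

(** Smoothness on a set (used for open sets only). *)

Fixpoint Ck (R : realType) (E F : normedModType R) (k : nat) (U : set E)
    (f : E -> F) : Prop :=
  match k with
  | 0%N => forall u, U u -> {for u, continuous f}
  | k'.+1 => (forall u, U u -> differentiable f u) /\
             (forall v : E, Ck k' U ('D_v f))
  end.

Definition smooth (R : realType) (E F : normedModType R) (U : set E)
  (f : E -> F) : Prop := forall k, Ck k U f.

(** The space form N^(d+1)(rho) in R^(d+2) = 'rV_(d + 2): a sphere, an affine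
    hyperplane {last coordinate = c}, or the upper sheet of a hyperboloid in
    Minkowski space, whose time-like coordinate is the last one.  The
    parameter c only plays a role when rho = 0. *)

Section SpaceForm.
Variables (R : realType) (d : nat) (rho c : R).

Definition last_idx : 'I_(d + 2) := rshift d ord_max.

Definition ambient_mx : 'M[R]_(d + 2) :=
  diag_mx (\row_i (if (rho < 0) && (i == last_idx) then -1 else 1)).

Definition form (x y : 'rV[R]_(d + 2)) : R := (x *m ambient_mx *m y^T) 0 0.

Definition space_form : set 'rV[R]_(d + 2) :=
  [set x : 'rV[R]_(d + 2) | if rho == 0 then x 0 last_idx = c
           else form x x = rho^-1 /\ (rho < 0 -> 0 < x 0 last_idx)].

Definition tangent_space (x : 'rV[R]_(d + 2)) : set 'rV[R]_(d + 2) :=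
  [set y : 'rV[R]_(d + 2) | if rho == 0 then y 0 last_idx = 0 else form x y = 0].

(** Every isometry of N^(d+1)(rho) is the restriction of such a map; b is
    automatically 0 when rho <> 0. *)
Definition space_form_isometry (T : 'rV[R]_(d + 2) -> 'rV[R]_(d + 2)) : Prop :=
  exists (A : 'M[R]_(d + 2)) (b : 'rV[R]_(d + 2)),
    [/\ forall x, T x = x *m A + b,
        A *m ambient_mx *m A^T = ambient_mx &
        forall x, space_form x -> space_form (T x)].

End SpaceForm.

(** Hypersurfaces of N^(m+1)(rho) given by local
    parametrizations f : U -> N, U an open subset of R^m.  Jacobians act on
    row vectors, so that row j of 'J f u is the j-th partial derivative. *)

Section Patch.
Variables (R : realType) (m : nat) (rho c : R).
Implicit Types (U : set 'rV[R]_m) (f eta : 'rV[R]_m -> 'rV[R]_(m + 2)).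

Definition immersed_patch U f : Prop :=
  [/\ open U, smooth U f, (forall u, U u -> space_form rho c (f u)) &
      (forall u, U u -> row_free ('J f u))].

Definition unit_normal U f eta : Prop :=
  smooth U eta /\
  forall u, U u ->
    [/\ tangent_space rho (f u) (eta u), form rho (eta u) (eta u) = 1 &
        forall v, form rho ('D_v f u) (eta u) = 0].

Definition first_ff f (u : 'rV[R]_m) : 'M[R]_m :=
  'J f u *m ambient_mx m rho *m ('J f u)^T.

(** Entry (i, j) is - < D_i f, D_j eta >; the tangential part of D_j eta in
    R^(m+2) is the covariant derivative of eta in N. *)
Definition second_ff f eta (u : 'rV[R]_m) : 'M[R]_m :=
  - ('J f u *m ambient_mx m rho *m ('J eta u)^T).

(** Matrix of S_eta in the coordinate frame, acting on column vectors. *)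
Definition shape_op f eta (u : 'rV[R]_m) : 'M[R]_m :=
  invmx (first_ff f u) *m second_ff f eta u.

Definition mean_curvature f eta (u : 'rV[R]_m) : R :=
  \tr (shape_op f eta u) / m%:R.

(** Components of grad h in the coordinate frame. *)
Definition grad f (h : 'rV[R]_m -> R) (u : 'rV[R]_m) : 'cV[R]_m :=
  invmx (first_ff f u) *m \col_i 'D_(delta_mx 0 i) h u.

Definition biconservative_at f eta (u : 'rV[R]_m) : Prop :=
  let H := mean_curvature f eta in
  2%:R *: (shape_op f eta u *m grad f H u)
    + (m%:R * H u) *: grad f H u = 0.

(** An immersed hypersurface is represented by a family of local
    parametrizations. *)
Definition patches := set 'rV[R]_m -> ('rV[R]_m -> 'rV[R]_(m + 2)) -> Prop.

Definition immersed_hypersurface (M : patches) : Prop :=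
  forall U f, M U f -> immersed_patch U f.

Definition biconservative (M : patches) : Prop :=
  forall U f eta, M U f -> unit_normal U f eta ->
    forall u, U u -> biconservative_at f eta u.

(** Patchwise constancy is global constancy when M is connected and oriented
    and its patches have connected domains. *)
Definition cmc (M : patches) : Prop :=
  forall U f eta, M U f -> unit_normal U f eta ->
    exists h : R, forall u, U u -> mean_curvature f eta u = h.

End Patch.

(** Local parametrizations of the unit sphere S^k of R^(k+1). *)
Definition sphere_patch (R : realType) (k : nat) (V : set 'rV[R]_k)
    (phi : 'rV[R]_k -> 'rV[R]_(k.+1)) : Prop :=
  [/\ open V /\ connected V, smooth V phi,
      (forall v, V v -> (phi v *m (phi v)^T) 0 0 = 1) &
      (forall v, V v -> row_free ('J phi v))].

(** The hypersurface (x1(s) phi, x2(s), x3(s)), s in I, phi in S^k, where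
    gamma = (x1, x2, x3); coordinates are (s, v) with v a coordinate on S^k. *)
Definition rotational (R : realType) (k : nat) (I : set R)
    (gamma : R -> 'rV[R]_(1 + 2)) : patches R k.+1 :=
  fun U f => exists (V : set 'rV[R]_k) (phi : 'rV[R]_k -> 'rV[R]_(k.+1)),
    [/\ sphere_patch V phi,
        U = [set u : 'rV[R]_(1 + k) | I (lsubmx u 0 0) /\ V (rsubmx u)] &
        f = fun u : 'rV[R]_(1 + k) =>
              row_mx (gamma (lsubmx u 0 0) 0 0 *: phi (rsubmx u))
                     (rsubmx (gamma (lsubmx u 0 0)))].

Section Curve.
Variables (R : realType) (rho c : R).
Implicit Types (I : set R) (gamma nu : R -> 'rV[R]_(1 + 2)).

Definition arclength_curve I gamma : Prop :=
  smooth I gamma /\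
  forall s, I s -> space_form rho c (gamma s) /\
                   form rho (derive1 gamma s) (derive1 gamma s) = 1.

Definition curve_normal I gamma nu : Prop :=
  smooth I nu /\
  forall s, I s ->
    [/\ tangent_space rho (gamma s) (nu s), form rho (nu s) (nu s) = 1 &
        form rho (derive1 gamma s) (nu s) = 0].

(** Signed curvature in N^2(rho): gamma'' and the covariant derivative of
    gamma' have the same component along nu. *)
Definition curvature gamma nu (s : R) : R :=
  form rho (derive1 (derive1 gamma) s) (nu s).

Definition euler_lagrange (P kappa : R -> R) (s : R) : Prop :=
  derive1 (derive1 (derive1 P \o kappa)) s
    + derive1 P (kappa s) * (kappa s ^+ 2 + rho)
    - kappa s * P (kappa s) = 0.

(** First integral of the Euler-Lagrange equation: the squared length of the
    vector of R^3 (a translation-invariant one in the plane if rho = 0) that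
    generates the Killing field extending P'(kappa) B along the curve.  The
    evolution under that field has spherical orbits iff it is positive, which
    is automatic for P = kappa^p, p <> 1, when rho >= 0. *)
Definition first_integral (P kappa : R -> R) (s : R) : R :=
  derive1 (derive1 P \o kappa) s ^+ 2
  + (kappa s * derive1 P (kappa s) - P (kappa s)) ^+ 2
  + rho * derive1 P (kappa s) ^+ 2.

End Curve.

(* Main.v *)
(* In the coordinates (s, phi) the shape operator of the rotational hypersurface
   is diag(kappa, -lam, ..., -lam) with lam = nu_1 / x_1, and the gradient of the
   mean curvature H points along the profile curve.  Hence biconservativity reads
   H' (3 kappa - (n - 2) lam) = 0.  Together with the Frenet equations
   gamma'' = kappa nu - rho gamma and nu' = - kappa gamma', the relation
   3 kappa x_1 = (n - 2) nu_1 says that x_1 is proportional to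
   q = p kappa^(p-1), and x_1'' = kappa nu_1 - rho x_1 becomes the Euler-Lagrange
   equation.  Conversely, along a solution of that equation the vector
   W = q' gamma' + (kappa^p - kappa q) nu + rho q gamma is constant, and <W, W> is
   the first integral.  An isometry carrying W / |W| to the axis of the
   coordinate x_1 makes x_1 proportional to q again.  Finally, H' cannot vanish on
   only part of the interval, because where it does not vanish
   (n - 1) H' = - 2 kappa'. *)

(* The exponent is forced by 3 kappa x_1 = (n - 2) nu_1. Differentiating with nu_1' = - kappa x_1'
   gives 3 kappa' x_1 = - (n + 1) kappa x_1', so x_1 is a multiple of kappa^(-3/(n + 1)), and -3/(n
   + 1) = p - 1 exactly for p = (n - 2)/(n + 1). In the code k = n - 2. Two obstacles shape the
   proof. The hypotheses speak of every patch and every unit normal, whose sign is compared with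
   that of the rotated nu only locally; it disappears from the biconservative equation because it
   enters squared. And for rho = 0 the position vector is not normal to the space form, while <W,
   gamma> agrees with q only up to a constant; the isometry then needs a translation as well. *)
Require Import Defs.
From HB Require Import structures.
From mathcomp Require Import all_boot all_order all_algebra.
From mathcomp Require Import all_classical all_reals all_analysis.
From mathcomp Require Import ring lra.
Import Order.TTheory GRing.Theory Num.Theory.
Import numFieldNormedType.Exports.
(* Restores [form], which all_algebra shadows. *)
Import Defs.
Local Open Scope classical_set_scope.
Local Open Scope ring_scope.
Set Implicit Arguments.
Unset Strict Implicit.
Unset Printing Implicit Defensive.


(** * Calculus of C^k maps *)

Section Differentiation.
Context {R : realType}.
Implicit Types E F G : normedModType R.

Lemma near_eq_differentiable E F (f g : E -> F) (x : E) :
  (\near x, f x = g x) -> differentiable f x -> differentiable g x.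
Proof.
move=> fg /diff_locallyP[dc df].
have dg : g \o shift x = cst (g x) + 'd f x +o_ 0 id.
  apply/eqaddoP => e e0; have /eqaddoP/(_ e e0) := df.
  apply: filter_app.
  have : \forall z \near (0 : E), f (z + x) = g (z + x).
    by have := fg; rewrite (near_shift 0) subr0.
  apply: filter_app; apply: nearW => y fgy.
  by rewrite /= !fctE /= fgy (nbhs_singleton fg).
(* The expansion shows that the differential of f serves g at x as well; uniqueness of the
   differential turns this into an equality. *)
by apply/diff_locallyP; rewrite (diff_unique dc dg).
Qed.

Lemma diff_scalef E F (a : E -> R) (f : E -> F) x :
  differentiable a x -> differentiable f x ->
  differentiable (fun y => a y *: f y) x /\
  forall v, 'D_v (fun y => a y *: f y) x = a x *: 'D_v f x + 'D_v a x *: f x.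
Proof.
move=> da df.
(* Scaling is packed as a bilinear map, so that the product rule becomes the chain rule along y |->
   (a y, f y). *)
have bl : bilinear_for (GRing.Scale.Law.clone _ _ *:%R _)
   (GRing.Scale.Law.clone _ _ *:%R _) (@GRing.scale R F).
  split=> u b y z /=; first by rewrite scalerDl scalerA.
  by rewrite scalerDr !scalerA mulrC.
pose bM := @bilinear_isBilinear.Build R R F F _ _ (@GRing.scale R F) bl.
pose B : {bilinear R -> F -> F} := HB.pack (@GRing.scale R F) bM.
have Bc : continuous (fun p : R * F => B p.1 p.2).
  by move=> p; exact: scale_continuous.
have dB p : differentiable (fun p : R * F => B p.1 p.2) p.
  exact: differentiable_bilin.
have dp : differentiable (fun y => (a y, f y)) x by exact: differentiable_pair.
have -> : (fun y => a y *: f y) =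
   (fun p : R * F => B p.1 p.2) \o (fun y => (a y, f y)) by [].
have dc := differentiable_comp dp (dB _).
split=> // v.
by rewrite !deriveE// diff_comp// diff_bilin//= diff_pair.
Qed.

Lemma diff_linear_comp E F G (L : {linear F -> G}) (f : E -> F) x :
  continuous L -> differentiable f x ->
  differentiable (fun y => L (f y)) x /\
  forall v, 'D_v (fun y => L (f y)) x = L ('D_v f x).
Proof.
move=> cL df.
have dL z : differentiable L z by exact: linear_differentiable.
have dc := differentiable_comp df (dL _).
by split=> // v; rewrite !deriveE// diff_comp// diff_lin.
Qed.

Lemma diff_comp_linear E F G (L : {linear E -> F}) (f : F -> G) x :
  continuous L -> differentiable f (L x) ->
  differentiable (fun y => f (L y)) x /\
  forall v, 'D_v (fun y => f (L y)) x = 'D_(L v) f (L x).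
Proof.
move=> cL df.
have dL z : differentiable L z by exact: linear_differentiable.
have dc := differentiable_comp (dL _) df.
by split=> // v; rewrite !deriveE// diff_comp// diff_lin.
Qed.

End Differentiation.

Section Smooth.
Context {R : realType}.
Implicit Types E F G : normedModType R.

(** The derivative formulas in the inductions below hold on U only, so functions have to be
    exchanged for others that agree with them there; openness of U makes the germs equal. *)
Lemma Ck_eq E F k (U : set E) (f g : E -> F) : open U ->
  (forall u, U u -> f u = g u) -> Ck k U f -> Ck k U g.
Proof.
move=> oU; elim: k f g => [|k IH] f g fg /=.
  move=> cf u Uu; change (g @ u --> g u); rewrite -(fg u Uu).
  apply: cvg_trans (cf u Uu); apply: near_eq_cvg.
  by near=> y; apply/fg; near: y; exact: open_nbhs_nbhs.
have nfg u : U u -> \near u, f u = g u.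
  by move=> Uu; near=> y; apply/fg; near: y; exact: open_nbhs_nbhs.
case=> df Df; split.
  by move=> u Uu; apply: near_eq_differentiable (df u Uu); exact: nfg.
move=> v; apply: IH (Df v) => u Uu.
by apply: near_eq_derive; exact: nfg.
Unshelve. all: by end_near. Qed.

Lemma CkW E F k (U : set E) (f : E -> F) : Ck k.+1 U f -> Ck k U f.
Proof.
elim: k f => [|k IH] f /=; first by case=> df _ u /df/differentiable_continuous.
by case=> df Df; split=> // v; apply: IH; exact: Df.
Qed.

Lemma Ck_cst E F k (U : set E) (c : F) : Ck k U (cst c).
Proof.
elim: k c => [|k IH] c /=; first by move=> u _; exact: cvg_cst.
split=> [u _|v]; first exact: differentiable_cst.
by rewrite (_ : 'D_v _ = cst 0)//; apply/funext => x; rewrite derive_cst.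
Qed.

Lemma Ck_add E F k (U : set E) (f g : E -> F) : open U ->
  Ck k U f -> Ck k U g -> Ck k U (fun u => f u + g u).
Proof.
move=> oU; elim: k f g => [|k IH] f g /=.
  by move=> cf cg u Uu; apply: cvgD; [exact: cf|exact: cg].
move=> [df Df] [dg Dg]; split=> [u Uu|v].
  by apply: differentiableD; [exact: df|exact: dg].
apply: Ck_eq (IH _ _ (Df v) (Dg v)) => // u Uu.
by rewrite -deriveD//; apply: diff_derivable; [exact: df|exact: dg].
Qed.

Lemma Ck_scale E F k (U : set E) (a : E -> R) (f : E -> F) : open U ->
  Ck k U a -> Ck k U f -> Ck k U (fun u => a u *: f u).
Proof.
move=> oU; elim: k a f => [|k IH] a f /=.
  by move=> cf cg u Uu; apply: cvgZ; [exact: cf|exact: cg].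
(* In the Leibniz rule each derivative is multiplied by an undifferentiated factor, which is needed
   at order k rather than k + 1. *)
move=> Ca Cf; have Ca' := CkW Ca; have Cf' := CkW Cf.
case: Ca Cf => da Da [df Df]; split=> [u Uu|v].
  by have [] := diff_scalef (da u Uu) (df u Uu).
apply: Ck_eq (Ck_add oU (IH _ _ Ca' (Df v)) (IH _ _ (Da v) Cf')) => // u Uu.
by have [_ ->] := diff_scalef (da u Uu) (df u Uu).
Qed.

Lemma Ck_inv E k (U : set E) (a : E -> R) : open U ->
  (forall u, U u -> a u != 0) -> Ck k U a -> Ck k U (fun u => (a u)^-1).
Proof.
move=> oU a0; elim: k => [|k IH] /=.
  by move=> ca u Uu; apply: cvgV; [exact: a0|exact: ca].
move=> Ca; have Ca' := CkW Ca.
case: Ca => da Da; split=> [u Uu|v].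
  by apply: differentiableV; [exact: da|exact: a0].
have Ci := IH Ca'.
have Cii := Ck_scale oU Ci Ci.
have CD := Ck_scale oU (Ck_cst k U (-1 : R)) (Da v).
have Cp := Ck_scale oU Cii CD.
apply: (Ck_eq oU _ Cp) => u Uu.
rewrite deriveV ?a0//; last by apply: diff_derivable; exact: da.
rewrite /= scaleN1r scalerN scaleNr; congr (- (_ *: _)).
by rewrite expr2 invfM.
Qed.

Lemma Ck_linear_comp E F G k (U : set E) (L : {linear F -> G}) (f : E -> F) :
  open U -> continuous L -> Ck k U f -> Ck k U (fun u => L (f u)).
Proof.
move=> oU cL; elim: k f => [|k IH] f /=.
  by move=> cf u Uu; apply: cvg_comp (cf u Uu) (cL _).
move=> [df Df]; split=> [u Uu|v].
  by have [] := diff_linear_comp cL (df u Uu).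
apply: Ck_eq (IH _ (Df v)) => // u Uu.
by have [_ ->] := diff_linear_comp cL (df u Uu).
Qed.

Lemma Ck_comp_linear E F G k (U : set E) (V : set F) (L : {linear E -> F})
    (f : F -> G) : open U -> continuous L -> (forall u, U u -> V (L u)) ->
  Ck k V f -> Ck k U (fun u => f (L u)).
Proof.
move=> oU cL UV; elim: k f => [|k IH] f /=.
  by move=> cf u Uu; apply: cvg_comp (cL _) (cf _ (UV _ Uu)).
move=> [df Df]; split=> [u Uu|v].
  by have [] := diff_comp_linear cL (df _ (UV _ Uu)).
apply: Ck_eq (IH _ (Df (L v))) => // u Uu.
by have [_ ->] := diff_comp_linear cL (df _ (UV _ Uu)).
Qed.

Lemma Ck_linear E F k (U : set E) (L : {linear E -> F}) :
  continuous L -> Ck k U L.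
Proof.
move=> cL; case: k => [|k] /=; first by move=> u _; exact: cL.
split=> [u _|v]; first exact: linear_differentiable.
rewrite (_ : 'D_v _ = cst (L v)); first exact: Ck_cst.
by apply/funext => x; rewrite deriveE ?diff_lin//; exact: linear_differentiable.
Qed.

End Smooth.

(** * The ambient bilinear form *)

Section LinearMaps.
Context {R : realType}.

Lemma rV_linear_continuous n (F : normedModType R) (L : {linear 'rV[R]_n -> F}) :
  continuous L.
Proof.
have -> : (L : 'rV[R]_n -> F) =
    \sum_(i < n) (fun x : 'rV[R]_n => (x 0 i : R) *: L (delta_mx 0 i)).
  apply/funext => x; rewrite fct_sumE {1}(row_sum_delta x) linear_sum.
  by apply: eq_bigr => i _; rewrite linearZ.
move=> x; apply/differentiable_continuous/differentiable_sum => i.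
apply: differentiableZl; exact: differentiable_coord.
Qed.

Section Projections.
Variables (m n : nat).

(** The projection to s, the injections and the coordinates are named so that they carry a
    [{linear}] structure; a rotational map is then assembled from linear maps, one scaling and one
    sum, as [rotE] shows. *)
Definition left_part (u : 'rV[R]_(1 + n)) : R := lsubmx u 0 0.
Lemma left_part_linear : linear left_part.
Proof. by move=> a u v; rewrite /left_part linearP !mxE. Qed.
HB.instance Definition _ := GRing.isLinear.Build R 'rV[R]_(1 + n) R _
  left_part left_part_linear.

Definition inl_mx (x : 'rV[R]_m) : 'rV[R]_(m + n) := row_mx x 0.
Lemma inl_mx_linear : linear inl_mx.
Proof. by move=> a u v; rewrite /inl_mx scale_row_mx add_row_mx scaler0 addr0. Qed.
HB.instance Definition _ := GRing.isLinear.Build R 'rV[R]_m _ _ inl_mx inl_mx_linear.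

Definition inr_mx (x : 'rV[R]_n) : 'rV[R]_(m + n) := row_mx 0 x.
Lemma inr_mx_linear : linear inr_mx.
Proof. by move=> a u v; rewrite /inr_mx scale_row_mx add_row_mx scaler0 addr0. Qed.
HB.instance Definition _ := GRing.isLinear.Build R 'rV[R]_n _ _ inr_mx inr_mx_linear.
End Projections.

Definition rV_coord n (i : 'I_n) (u : 'rV[R]_n) : R := u 0 i.
Lemma rV_coord_linear n i : linear (@rV_coord n i).
Proof. by move=> a u v; rewrite /rV_coord !mxE. Qed.
HB.instance Definition _ n i :=
  GRing.isLinear.Build R 'rV[R]_n R _ (@rV_coord n i) (@rV_coord_linear n i).

End LinearMaps.

Section Form.
Context {R : realType}.
Variable (rho : R).

Local Notation J d := (ambient_mx d rho).

(** The last two coordinates are those that the rotations fix, and the time-like one is among them.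
    Their block is the same in every dimension, which allows the form on R^3 to be compared with the
    form on R^(n+1). *)
Definition tail_mx : 'M[R]_2 := drsubmx (J 1).

Lemma ambient_mx_block d : J d = block_mx 1%:M 0 0 tail_mx.
Proof.
apply/matrixP => i j.
rewrite -(fintype.splitK i) -(fintype.splitK j) /unsplit.
case: (fintype.split i) => i'; case: (fintype.split j) => j'.
- by rewrite block_mxEul !mxE eq_lshift /last_idx eq_lrshift andbF.
- by rewrite block_mxEur !mxE eq_lrshift.
- by rewrite block_mxEdl !mxE eq_rlshift.
- by rewrite block_mxEdr !mxE /last_idx !eq_rshift.
Qed.

Lemma ambient_mx_tr d : (J d)^T = J d.
Proof. exact: tr_diag_mx. Qed.

Lemma formE d (x y : 'rV[R]_(d + 2)) :
  form rho x y = \sum_i J d i i * (x 0 i * y 0 i).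
Proof.
rewrite /form /ambient_mx mul_mx_diag mxE; apply: eq_bigr => i _.
by rewrite !mxE eqxx mulr1n mulrAC mulrC.
Qed.

Lemma formC d (x y : 'rV[R]_(d + 2)) : form rho x y = form rho y x.
Proof. by rewrite !formE; apply: eq_bigr => i _; rewrite (mulrC (x 0 i)). Qed.

Lemma form0l d (x : 'rV[R]_(d + 2)) : form rho 0 x = 0.
Proof. by rewrite /form !mul0mx mxE. Qed.

Lemma formDl d (x y z : 'rV[R]_(d + 2)) :
  form rho (x + y) z = form rho x z + form rho y z.
Proof. by rewrite /form !mulmxDl mxE. Qed.

Lemma formZl d a (x z : 'rV[R]_(d + 2)) : form rho (a *: x) z = a * form rho x z.
Proof. by rewrite /form -!scalemxAl mxE. Qed.

Lemma formNl d (x z : 'rV[R]_(d + 2)) : form rho (- x) z = - form rho x z.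
Proof. by rewrite -scaleN1r formZl mulN1r. Qed.

Lemma formDr d (x y z : 'rV[R]_(d + 2)) :
  form rho z (x + y) = form rho z x + form rho z y.
Proof. by rewrite formC formDl !(formC z). Qed.

Lemma formZr d a (x z : 'rV[R]_(d + 2)) : form rho z (a *: x) = a * form rho z x.
Proof. by rewrite formC formZl formC. Qed.

Lemma formNr d (x z : 'rV[R]_(d + 2)) : form rho z (- x) = - form rho z x.
Proof. by rewrite formC formNl formC. Qed.

Lemma form_mulmx d (A : 'M[R]_(d + 2)) (x y : 'rV[R]_(d + 2)) :
  A *m J d *m A^T = J d -> form rho (x *m A) (y *m A) = form rho x y.
Proof.
move=> AJ; rewrite /form trmx_mul !mulmxA -(mulmxA x A) -(mulmxA x (A *m _)).
by rewrite AJ.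
Qed.

Lemma form_row_mx d (x y : 'rV[R]_d) (z w : 'rV[R]_2) :
  form rho (row_mx x z) (row_mx y w) =
    (x *m y^T) 0 0 + (z *m tail_mx *m w^T) 0 0.
Proof.
rewrite /form ambient_mx_block mul_row_block !mulmx0 addr0 add0r mulmx1.
by rewrite tr_row_mx mul_row_col mxE.
Qed.

Lemma form_mx d m n (A : 'M[R]_(m, d + 2)) (B : 'M[R]_(n, d + 2)) i j :
  (A *m J d *m B^T) i j = form rho (row i A) (row j B).
Proof. by rewrite /form -row_mul !mxE; apply: eq_bigr => k _; rewrite !mxE. Qed.

(* Spans the normal line at x of the space form in the ambient space. *)
Definition sf_normal d (x : 'rV[R]_(d + 2)) : 'rV[R]_(d + 2) :=
  if rho == 0 then delta_mx 0 (last_idx d) else x.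

Lemma ambient_mx_rho0 d : rho = 0 -> J d = 1%:M.
Proof.
move=> r0; rewrite -diag_const_mx; congr diag_mx.
by apply/rowP => i; rewrite !mxE r0 ltxx.
Qed.

Lemma form_sf_normalE d (x y : 'rV[R]_(d + 2)) :
  form rho (sf_normal x) y = if rho == 0 then y 0 (last_idx d) else form rho x y.
Proof.
rewrite /sf_normal; case: eqP => // r0.
rewrite /form ambient_mx_rho0// mulmx1 mxE (bigD1 (last_idx d))//= big1 ?addr0.
  by rewrite !mxE !eqxx mul1r.
by move=> i /negbTE ii; rewrite !mxE ii andbF mul0r.
Qed.

Lemma tangent_spaceP d (x y : 'rV[R]_(d + 2)) :
  tangent_space rho x y <-> form rho (sf_normal x) y = 0.
Proof. by rewrite form_sf_normalE /tangent_space/=; case: eqP. Qed.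

Lemma form_sf_normal_cst d (c : R) (x : 'rV[R]_(d + 2)) : space_form rho c x ->
  form rho (sf_normal x) x = if rho == 0 then c else rho^-1.
Proof. by rewrite form_sf_normalE /space_form/=; case: eqP => // _ []. Qed.

Lemma form_sf_normal d (c : R) (x : 'rV[R]_(d + 2)) :
  space_form rho c x -> form rho (sf_normal x) (sf_normal x) != 0.
Proof.
move=> /form_sf_normal_cst; rewrite !form_sf_normalE /sf_normal.
case: eqP => [_ _|/eqP r0 ->]; last by rewrite invr_eq0.
by rewrite mxE !eqxx oner_eq0.
Qed.

(* The Gram matrix of the frame (T, e, N) is invertible. *)
Lemma frame_separates d (T : 'M[R]_(d, d + 2)) (e N x : 'rV[R]_(d + 2)) :
  T *m J d *m T^T \in unitmx -> form rho e e = 1 -> form rho e N = 0 ->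
  form rho N N != 0 ->
  (forall i, form rho (row i T) e = 0) -> (forall i, form rho (row i T) N = 0) ->
  (forall i, form rho (row i T) x = 0) -> form rho e x = 0 -> form rho N x = 0 ->
  x = 0.
Proof.
move=> uT ee eN NN Te TN Tx ex Nx.
have mx11 (y z : 'rV[R]_(d + 2)) : y *m J d *m z^T = (form rho y z)%:M.
  by rewrite [LHS]mx11_scalar.
have Tz z : (forall i, form rho (row i T) z = 0) -> T *m J d *m z^T = 0.
  move=> h; apply/matrixP => i j; rewrite form_mx mxE.
  by rewrite (_ : row j z = z) ?h//; apply/rowP => k; rewrite mxE ord1.
have Tz' z : (forall i, form rho (row i T) z = 0) -> z *m J d *m T^T = 0.
  move=> /Tz h; apply: trmx_inj.
  by rewrite !trmx_mul trmxK ambient_mx_tr mulmxA h trmx0.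
pose E : 'M[R]_(d + (1 + 1), d + 2) := col_mx T (col_mx e N).
have EJE : E *m J d *m E^T =
   block_mx (T *m J d *m T^T) 0 0 (block_mx 1%:M 0 0 (form rho N N)%:M).
  rewrite /E !mul_col_mx !tr_col_mx !mul_mx_row.
  rewrite !mx11.
  rewrite !(Tz e)// !(Tz N)// !(Tz' e)// !(Tz' N)// ee eN formC eN.
  rewrite !raddf0 row_mx0; congr col_mx.
  by rewrite -[LHS]/(block_mx 0 _ 0 _) block_mxEh col_mx0.
have uE : E *m J d *m E^T \in unitmx.
  rewrite EJE unitmxE !det_ublock !det1 mul1r det_scalar expr1 unitrM -unitmxE uT.
  by rewrite unitfE.
have uE' : E *m J d \in unitmx.
  by move: uE; rewrite unitmx_mul => /andP[].
have Ex : (E *m J d) *m x^T = 0.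
  by rewrite /E !mul_col_mx (Tz x Tx) !mx11 ex Nx// !raddf0 !col_mx0.
apply: trmx_inj; rewrite trmx0 -(mulKmx uE' x^T).
by rewrite Ex mulmx0.
Qed.

End Form.

(** * Rotational parametrizations *)

Section SmoothExtra.
Context {R : realType}.
Implicit Types E F : normedModType R.

Lemma Ck_sum E F k (U : set E) n (f : 'I_n -> E -> F) : open U ->
  (forall i, Ck k U (f i)) -> Ck k U (fun u => \sum_i f i u).
Proof.
move=> oU; elim: n f => [|n IH] f Cf.
  by apply: (Ck_eq oU _ (Ck_cst k U 0)) => u _; rewrite big_ord0.
apply: (Ck_eq oU _ (Ck_add oU (IH _ (fun i => Cf (widen_ord (leqnSn n) i))) (Cf ord_max))).
by move=> u _; rewrite big_ord_recr.
Qed.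

Definition mulmxr_coord m n (M : 'M[R]_(m, n)) (i : 'I_n) (x : 'rV[R]_m) : R :=
  (x *m M) 0 i.
Lemma mulmxr_coord_linear m n (M : 'M[R]_(m, n)) i : linear (mulmxr_coord M i).
Proof. by move=> a u v; rewrite /mulmxr_coord mulmxDl -scalemxAl mxE mxE. Qed.
HB.instance Definition _ m n (M : 'M[R]_(m, n)) i :=
  GRing.isLinear.Build R 'rV[R]_m R _ (mulmxr_coord M i) (@mulmxr_coord_linear m n M i).

(** As a sum of products of scalar linear functions, a bilinear expression inherits smoothness and
    the Leibniz rule from the scalar case. *)
Lemma bilinE m n (M : 'M[R]_(m, n)) (x : 'rV[R]_m) (y : 'rV[R]_n) :
  (x *m M *m y^T) 0 0 = \sum_i mulmxr_coord M i x * rV_coord i y.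
Proof.
rewrite mxE; apply: eq_bigr => i _; congr (_ * _).
by rewrite mxE.
Qed.

Lemma Ck_bilin E k (U : set E) m n (M : 'M[R]_(m, n)) (f : E -> 'rV[R]_m)
    (g : E -> 'rV[R]_n) : open U -> Ck k U f -> Ck k U g ->
  Ck k U (fun u => (f u *m M *m (g u)^T) 0 0).
Proof.
move=> oU Cf Cg.
have Ci i := Ck_scale oU
  (Ck_linear_comp (L := mulmxr_coord M i) oU (@rV_linear_continuous _ _ _ _) Cf)
  (Ck_linear_comp (L := rV_coord i) oU (@rV_linear_continuous _ _ _ _) Cg).
by apply: (Ck_eq oU _ (Ck_sum oU Ci)) => u _; rewrite bilinE.
Qed.

Lemma is_derive_bilin E m n (M : 'M[R]_(m, n)) (f : E -> 'rV[R]_m)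
    (g : E -> 'rV[R]_n) u v : differentiable f u -> differentiable g u ->
  is_derive u v (fun u => (f u *m M *m (g u)^T) 0 0)
    (('D_v f u *m M *m (g u)^T) 0 0 + (f u *m M *m ('D_v g u)^T) 0 0).
Proof.
move=> df dg.
have -> : (fun u => (f u *m M *m (g u)^T) 0 0) =
   \sum_i (fun u => mulmxr_coord M i (f u)) * (fun u => rV_coord i (g u)).
  by apply/funext => x; rewrite fct_sumE bilinE.
have [dl Dl] := all_and2 (fun i => diff_linear_comp (L := mulmxr_coord M i)
  (@rV_linear_continuous _ _ _ _) df).
have [dr Dr] := all_and2 (fun i => diff_linear_comp (L := rV_coord i)
  (@rV_linear_continuous _ _ _ _) dg).
have dM i : derivable ((fun u => mulmxr_coord M i (f u)) *
    (fun u => rV_coord i (g u))) u v.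
  by apply: derivableM; apply: diff_derivable; [exact: dl|exact: dr].
apply: DeriveDef; first exact: derivable_sum.
rewrite derive_sum// !bilinE -big_split; apply: eq_bigr => i _.
rewrite deriveM; [|exact/diff_derivable/dl|exact/diff_derivable/dr].
by rewrite Dl Dr addrC /= mulrC.
Qed.
End SmoothExtra.

Section Rot.
Context {R : realType} (k : nat) (rho : R).
Implicit Types (a b : R -> 'rV[R]_(1 + 2)) (phi : 'rV[R]_k -> 'rV[R]_(k.+1)).

(** The curve [a] is arbitrary because three curves are used: gamma gives the immersion, gamma' its
    partial derivative along s, and nu its unit normal. *)
Definition rot a phi : 'rV[R]_(1 + k) -> 'rV[R]_(k.+1 + 2) := fun u =>
  row_mx (a (lsubmx u 0 0) 0 0 *: phi (rsubmx u)) (rsubmx (a (lsubmx u 0 0))).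

Definition rot_dom (I : set R) (V : set 'rV[R]_k) : set 'rV[R]_(1 + k) :=
  [set u | I (lsubmx u 0 0) /\ V (rsubmx u)].

Lemma rotE a phi : rot a phi = fun u => rV_coord 0 (a (left_part u)) *:
   inl_mx 2 (phi (rsubmx u)) + inr_mx k.+1 (rsubmx (a (left_part u))).
Proof.
apply/funext => u; rewrite /rot /inl_mx /inr_mx /rV_coord scale_row_mx scaler0.
by rewrite add_row_mx add0r addr0.
Qed.

Lemma rot_dom_open I V : open I -> open V -> open (rot_dom I V).
Proof.
move=> oI oV.
have -> : rot_dom I V = (@left_part R k) @^-1` I `&` rsubmx @^-1` V by [].
apply: openI; apply: open_comp => // x _; exact: rV_linear_continuous.
Qed.

Lemma smooth_rot I V a phi : open I -> open V -> smooth I a -> smooth V phi ->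
  smooth (rot_dom I V) (rot a phi).
Proof.
move=> oI oV sa sp n; have oU := rot_dom_open oI oV.
have Ca : Ck n (rot_dom I V) (fun u => a (left_part u)).
  apply: (Ck_comp_linear (L := @left_part R k) oU _ _ (sa n)).
    exact: rV_linear_continuous.
  by move=> u [].
have Cp : Ck n (rot_dom I V) (fun u : 'rV[R]_(1 + k) => phi (rsubmx u)).
  apply: (Ck_comp_linear (L := rsubmx) oU _ _ (sp n)).
    exact: rV_linear_continuous.
  by move=> u [].
rewrite rotE; apply: Ck_add => //.
  apply: Ck_scale => //.
    by apply: (Ck_linear_comp (L := rV_coord 0)) => //; exact: rV_linear_continuous.
  by apply: (Ck_linear_comp (L := inl_mx 2)) => //; exact: rV_linear_continuous.
apply: (Ck_linear_comp (L := @inr_mx R k.+1 2)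
  (f := fun u => rsubmx (a (left_part u)))) => //; first exact: rV_linear_continuous.
by apply: (Ck_linear_comp (L := rsubmx)) => //; exact: rV_linear_continuous.
Qed.

Lemma derive_real_dir (F : normedModType R) (f : R -> F) s t :
  differentiable f s -> 'D_t f s = t *: derive1 f s.
Proof.
by move=> df; rewrite derive1E !deriveE// -[in LHS](mulr1 t) -linearZ.
Qed.

Lemma derive_rot a phi u w :
  differentiable a (lsubmx u 0 0) -> differentiable phi (rsubmx u) ->
  differentiable (rot a phi) u /\
  'D_w (rot a phi) u = lsubmx w 0 0 *: rot (derive1 a) phi u +
     row_mx (a (lsubmx u 0 0) 0 0 *: 'D_(rsubmx w) phi (rsubmx u)) 0.
Proof.
move=> da dp; set s := lsubmx u 0 0.
have [dal Dal] := diff_comp_linear (L := @left_part R k) (f := a) (x := u)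
  (@rV_linear_continuous _ _ _ _) da.
have [dpr Dpr] := diff_comp_linear (L := rsubmx) (f := phi) (x := u)
  (@rV_linear_continuous _ _ _ _) dp.
have [dc Dc] := diff_linear_comp (L := rV_coord 0) (@rV_linear_continuous _ _ _ _) dal.
have [dt Dt] := diff_linear_comp (L := rsubmx) (@rV_linear_continuous _ _ _ _) dal.
have [di Di] := diff_linear_comp (L := inl_mx 2) (@rV_linear_continuous _ _ _ _) dpr.
have [dr Dr] := diff_linear_comp (L := @inr_mx R k.+1 2) (@rV_linear_continuous _ _ _ _) dt.
have [ds Ds] := diff_scalef dc di.
rewrite rotE; split; first exact: (differentiableD ds dr).
rewrite deriveD; try exact: diff_derivable.
rewrite Ds Dc Di Dr Dt Dal Dpr derive_real_dir//.
rewrite /rot /inl_mx /inr_mx /rV_coord !scale_row_mx !add_row_mx.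
congr row_mx.
  by rewrite addr0 /= [X in _ + X *: _]mxE -scalerA addrC.
by rewrite !scaler0 !add0r linearZ addr0.
Qed.

Lemma jacobian_rot a phi u :
  differentiable a (lsubmx u 0 0) -> differentiable phi (rsubmx u) ->
  ('J (rot a phi) u : 'M[R]_(1 + k, k.+1 + 2)) =
  block_mx (derive1 a (lsubmx u 0 0) 0 0 *: phi (rsubmx u))
           (rsubmx (derive1 a (lsubmx u 0 0)))
           (a (lsubmx u 0 0) 0 0 *: 'J phi (rsubmx u)) 0.
Proof.
move=> da dp; apply/row_matrixP => i; rewrite !rowE.
have [dr Dr] := derive_rot (delta_mx 0 i) da dp.
rewrite -deriveEjacobian// Dr deriveEjacobian// /rot.
set w := delta_mx 0 i; rewrite -[w in RHS]hsubmxK mul_row_block.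
rewrite scale_row_mx add_row_mx mulmx0 -scalemxAr addr0.
have e p (x : 'M[R]_(1, p)) : lsubmx w *m x = lsubmx w 0 0 *: x.
  by rewrite {1}(mx11_scalar (lsubmx w)) mul_scalar_mx.
by rewrite !e addr0 -scalemxAr !scalerA (mulrC (lsubmx w 0 0)).
Qed.

(** For a unit vector phi the map (x1, x2, x3) |-> (x1 phi, x2, x3) is a linear isometry onto its
    image. *)
Lemma form_rot a b phi u : (phi (rsubmx u) *m (phi (rsubmx u))^T) 0 0 = 1 ->
  form rho (rot a phi u) (rot b phi u) =
  form rho (a (lsubmx u 0 0)) (b (lsubmx u 0 0)).
Proof.
move=> p1; set s := lsubmx u 0 0.
rewrite -[a s in RHS]hsubmxK -[b s in RHS]hsubmxK !form_row_mx -/s.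
congr (_ + _); rewrite -scalemxAl linearZ -scalemxAr mxE [X in _ * X]mxE p1 mulr1.
by rewrite mxE big_ord1 !mxE; congr (a s 0 _ * b s 0 _); apply: val_inj.
Qed.

(** A single computation for both fundamental forms: with a = gamma, the choice b = gamma gives the
    first and b = nu, up to sign, the second. The mixed blocks vanish because phi is orthogonal to
    its own derivatives. *)
Lemma form_jacobian a b phi u :
  differentiable a (lsubmx u 0 0) -> differentiable b (lsubmx u 0 0) ->
  differentiable phi (rsubmx u) ->
  (phi (rsubmx u) *m (phi (rsubmx u))^T) 0 0 = 1 ->
  'J phi (rsubmx u) *m (phi (rsubmx u))^T = 0 ->
  ('J (rot a phi) u *m ambient_mx k.+1 rho *m ('J (rot b phi) u)^T : 'M[R]_(1 + k)) =
  block_mx (form rho (derive1 a (lsubmx u 0 0)) (derive1 b (lsubmx u 0 0)))%:M 0 0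
    ((a (lsubmx u 0 0) 0 0 * b (lsubmx u 0 0) 0 0) *:
       ('J phi (rsubmx u) *m ('J phi (rsubmx u))^T)).
Proof.
move=> da db dp p1 pJ; set s := lsubmx u 0 0.
have pJ' : phi (rsubmx u) *m ('J phi (rsubmx u))^T = 0.
  by apply: trmx_inj; rewrite trmx_mul trmxK pJ trmx0.
rewrite (jacobian_rot da dp) (jacobian_rot db dp) -/s ambient_mx_block.
rewrite mulmx_block !mulmx0 !mulmx1 !mul0mx !addr0 !add0r.
rewrite tr_block_mx mulmx_block trmx0 !mulmx0 !mul0mx !addr0.
rewrite !linearZ /= -?scalemxAl pJ pJ' !scaler0 !scalerA [b s _ _ * _]mulrC.
congr block_mx.
rewrite [LHS]mx11_scalar; congr (_%:M).
have := form_rot (derive1 a) (derive1 b) p1; rewrite -/s => <-.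
rewrite /rot form_row_mx mxE; congr (_ + _).
by rewrite [in RHS]linearZ /= -scalemxAl -scalemxAr scalerA mulrC.
Qed.

(** Differentiating |phi|^2 = 1 gives 2 <D_i phi, phi> = 0. *)
Lemma sphere_patch_jacobian V phi v : sphere_patch V phi -> V v ->
  'J phi v *m (phi v)^T = 0.
Proof.
case=> -[oV _] sp p1 _ Vv.
have dp : differentiable phi v by have [+ _] := sp 1%N; apply.
apply/row_matrixP => i; rewrite row0 rowE mulmxA -deriveEjacobian//.
rewrite [LHS]mx11_scalar; set x := (_ *m _) 0 0.
suff -> : x = 0 by rewrite raddf0.
have [_] := is_derive_bilin 1%:M (delta_mx 0 i) dp dp.
rewrite (near_eq_derive (g := cst (1 : R))).
  rewrite derive_cst !mulmx1 => /esym/eqP.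
  have -> : (phi v *m ('D_(delta_mx 0 i) phi v)^T) 0 0 = x.
    by rewrite /x !mxE; apply: eq_bigr => j _; rewrite [in LHS]mxE [in RHS]mxE mulrC.
  by rewrite -mulr2n mulrn_eq0 => /eqP.
near=> w; rewrite mulmx1; apply: p1; near: w; exact: open_nbhs_nbhs.
Unshelve. all: by end_near. Qed.

(** If v A A^T = 0 then |v A|^2 = 0; this is a sum of squares, so v A = 0, and v = 0 since A is row
    free. *)
Lemma gram_unit m n (A : 'M[R]_(m, n)) : row_free A -> A *m A^T \in unitmx.
Proof.
move=> fA; rewrite -row_free_unit; apply/row_freeP.
apply/row_freeP/inj_row_free => v vA0.
have : (v *m A) *m (v *m A)^T = 0.
  by rewrite trmx_mul mulmxA -(mulmxA v) vA0 mul0mx.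
move=> h; have vA : v *m A = 0.
  apply/rowP => j; rewrite [RHS]mxE; apply/eqP; rewrite -sqrf_eq0.
  have := congr1 (fun M : 'M[R]_1 => M 0 0) h.
  rewrite [RHS]mxE mxE => /eqP; rewrite psumr_eq0.
    move=> /allP/(_ j); rewrite mem_index_enum => /(_ isT)/=.
    by rewrite [X in _ * X]mxE expr2.
  by move=> i _; rewrite [X in _ * X]mxE -expr2 sqr_ge0.
by apply/eqP; rewrite -(mulmx_free_eq0 _ fA) vA.
Qed.
End Rot.

(** * Frenet equations *)

Section SmoothFacts.
Context {R : realType}.
Implicit Types E F : normedModType R.

Lemma smooth_differentiable E F (U : set E) (f : E -> F) u :
  smooth U f -> U u -> differentiable f u.
Proof. by move=> sf Uu; have [+ _] := sf 1%N; apply. Qed.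

Lemma smooth_derive1 F (I : set R) (f : R -> F) :
  smooth I f -> smooth I (derive1 f).
Proof.
move=> sf n; have [_ /(_ 1)] := sf n.+1.
by rewrite (_ : 'D_1 f = derive1 f)//; apply/funext => s; rewrite derive1E.
Qed.

Lemma derive1_eq_on F (I : set R) (f g : R -> F) s : open I -> I s ->
  (forall t, I t -> f t = g t) -> derive1 f s = derive1 g s.
Proof.
move=> oI Is fg; rewrite !derive1E; apply: near_eq_derive.
by near=> t; apply: fg; near: t; exact: open_nbhs_nbhs.
Unshelve. all: by end_near. Qed.

Lemma smooth_is_derive (I : set R) (f : R -> R) s : smooth I f -> I s ->
  is_derive s 1 f (derive1 f s).
Proof.
move=> sf Is; rewrite derive1E; apply/derivableP/diff_derivable.
exact: smooth_differentiable sf Is.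
Qed.

Lemma is_derive1E (f : R -> R) (s l : R) : is_derive s 1 f l -> derive1 f s = l.
Proof. by move=> df; rewrite derive1E derive_val. Qed.

End SmoothFacts.

Section Curve.
Context {R : realType}.
Variables (rho c : R) (I : set R).
Hypothesis oI : open I.
Implicit Types a b gamma nu : R -> 'rV[R]_(1 + 2).

Lemma smooth_form a b : smooth I a -> smooth I b ->
  smooth I (fun s => form rho (a s) (b s)).
Proof. by move=> sa sb n; exact: Ck_bilin. Qed.

Lemma derive_form a b s : smooth I a -> smooth I b -> I s ->
  derive1 (fun t => form rho (a t) (b t)) s =
  form rho (derive1 a s) (b s) + form rho (a s) (derive1 b s).
Proof.
move=> sa sb Is; apply: is_derive1E; rewrite !derive1E.
by apply: is_derive_bilin; exact: smooth_differentiable Is.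
Qed.

Lemma derive_form_cst a b s (l : R) : smooth I a -> smooth I b -> I s ->
  (forall t, I t -> form rho (a t) (b t) = l) ->
  form rho (derive1 a s) (b s) + form rho (a s) (derive1 b s) = 0.
Proof.
move=> sa sb Is ab; rewrite -derive_form//.
by rewrite (derive1_eq_on (g := cst l) oI Is ab) derive1_cst.
Qed.

Section Frenet.
Variables (gamma nu : R -> 'rV[R]_(1 + 2)).
Hypotheses (ac : arclength_curve rho c I gamma) (cn : curve_normal rho I gamma nu).
Local Notation kappa := (curvature rho gamma nu).

Lemma smooth_curvature : smooth I kappa.
Proof.
case: ac cn => sg _ [sn _]; apply: smooth_form => //.
by do 2!apply: smooth_derive1.
Qed.

Lemma form_velocity_normal s : I s ->
  form rho (derive1 gamma s) (derive1 nu s) = - kappa s.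
Proof.
case: ac cn => sg _ [sn nuP] Is; apply/eqP; rewrite eq_sym -subr_eq0 -opprD oppr_eq0.
apply/eqP; apply: (derive_form_cst (l := 0)) => //; first exact: smooth_derive1.
by move=> t /nuP[].
Qed.

Local Notation N s := (sf_normal rho (gamma s)).

(** The normal of the space form along gamma is gamma itself if rho <> 0 and a fixed vector if rho =
    0; the conditional is its derivative in the two cases. *)
Lemma derive_form_sf_normal (y : R -> 'rV[R]_(1 + 2)) l s : smooth I y -> I s ->
  (forall t, I t -> form rho (N t) (y t) = l) ->
  form rho (if rho == 0 then 0 else derive1 gamma s) (y s) +
  form rho (N s) (derive1 y s) = 0.
Proof.
case: ac => sg _ sy Is Ny.
have := derive_form_cst (a := fun t => N t) _ sy Is Ny.
rewrite /sf_normal; case: eqP => r0.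
  rewrite derive1_cst; apply => n; exact: Ck_cst.
by apply.
Qed.

Lemma tangent_velocity s : I s -> form rho (N s) (derive1 gamma s) = 0.
Proof.
case: ac => sg gP Is.
have := derive_form_sf_normal sg Is
  (fun t It => form_sf_normal_cst (gP t It).1).
rewrite form_sf_normalE; case: eqP => r0; first by rewrite form0l add0r.
by rewrite formC -mulr2n => /eqP; rewrite mulrn_eq0 => /eqP.
Qed.

(** Reduces each Frenet equation to three scalar identities, one for each vector of the frame
    (gamma', nu, N) of R^3. *)
Lemma frenet_frame s x : I s -> form rho (derive1 gamma s) x = 0 ->
  form rho (nu s) x = 0 -> form rho (N s) x = 0 -> x = 0.
Proof.
case: ac cn => sg gP [sn nuP] Is gx nx Nx.
have [sf g1] := gP s Is; have [tn n1 gn] := nuP s Is.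
have row1 i : row i (derive1 gamma s) = derive1 gamma s.
  by apply/rowP => j; rewrite mxE ord1.
apply: (frame_separates (T := derive1 gamma s) (e := nu s) (rho := rho)
  (N := N s)) => //.
- by rewrite [X in X \in _]mx11_scalar -/(form _ _ _) g1 unitmx1.
- by rewrite formC; exact/tangent_spaceP.
- exact: form_sf_normal sf.
- by move=> i; rewrite row1.
- by move=> i; rewrite row1 formC tangent_velocity.
- by move=> i; rewrite row1.
Qed.

Lemma frenet_velocity s : I s ->
  derive1 (derive1 gamma) s = kappa s *: nu s - rho *: gamma s.
Proof.
case: ac cn => sg gP [sn nuP] Is; apply/eqP; rewrite -subr_eq0; apply/eqP.
have [sf g1] := gP s Is; have [tn n1 gn] := nuP s Is.
have sg' := smooth_derive1 sg.
(* The factor rho makes these relations true in the flat case too, where gamma need not be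
   orthogonal to its tangent plane. *)
have gg0 : rho * form rho (gamma s) (derive1 gamma s) = 0.
  have := tangent_velocity Is; rewrite form_sf_normalE.
  by case: eqP => [->|_ ->]; rewrite ?mul0r ?mulr0.
have gn0 : rho * form rho (gamma s) (nu s) = 0.
  have /tangent_spaceP := tn; rewrite form_sf_normalE.
  by case: eqP => [->|_ ->]; rewrite ?mul0r ?mulr0.
apply: (frenet_frame Is); rewrite !(formDr, formNr, formZr).
- rewrite gn mulr0 sub0r opprK (formC _ _ (gamma s)) gg0 addr0.
  have := derive_form_cst sg' sg' Is (fun t It => (gP t It).2).
  by rewrite formC -mulr2n => /eqP; rewrite mulrn_eq0 => /eqP.
- rewrite (formC _ _ (gamma s)) gn0 n1 mulr1 subr0 formC.
  by rewrite /curvature subrr.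
- have /tangent_spaceP -> := tn.
  have := derive_form_sf_normal sg' Is tangent_velocity.
  rewrite (form_sf_normal_cst sf) mulr0 sub0r opprK.
  case: eqP => [r0|/eqP r0]; first by rewrite form0l r0 mul0r addr0 add0r.
  by rewrite g1 mulfV// addrC.
Qed.

Lemma frenet_normal s : I s -> derive1 nu s = - kappa s *: derive1 gamma s.
Proof.
case: ac cn => sg gP [sn nuP] Is; apply/eqP; rewrite -subr_eq0; apply/eqP.
have [sf g1] := gP s Is; have [tn n1 gn] := nuP s Is.
apply: (frenet_frame Is); rewrite !(formDr, formNr, formZr).
- by rewrite form_velocity_normal// g1 mulr1 subrr.
- rewrite (formC _ _ (derive1 gamma s)) gn mulr0 subr0.
  have := derive_form_cst sn sn Is (fun t It => let: And3 _ h _ := nuP t It in h).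
  by rewrite formC -mulr2n => /eqP; rewrite mulrn_eq0 => /eqP.
- rewrite tangent_velocity// mulr0 subr0.
  have := derive_form_sf_normal sn Is
    (fun t It => let: And3 h _ _ := nuP t It in (tangent_spaceP _ _ _).1 h).
  by case: eqP => _; rewrite ?form0l ?gn add0r.
Qed.
End Frenet.
End Curve.

(** * Shape operator of a rotational hypersurface *)

Section RotNormal.
Context {R : realType} (k : nat).
Variables (rho c : R).
Implicit Types (a b : R -> 'rV[R]_(1 + 2)) (phi : 'rV[R]_k -> 'rV[R]_(k.+1)).

Lemma rot_last a phi u :
  rot a phi u 0 (last_idx k.+1) = a (lsubmx u 0 0) 0 (last_idx 1).
Proof. by rewrite /rot /last_idx row_mxEr mxE. Qed.

Lemma sf_normal_rot a phi u : sf_normal rho (rot a phi u) =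
  rot (fun s => sf_normal rho (a s)) phi u.
Proof.
rewrite /sf_normal; case: eqP => // r0; rewrite /rot.
apply/rowP => i; rewrite mxE eqxx /= -(fintype.splitK i) /unsplit.
case: (fintype.split i) => j; rewrite /last_idx.
  by rewrite eq_lrshift row_mxEl !mxE /= mul0r.
by rewrite row_mxEr eq_rshift !mxE eq_rshift.
Qed.

Lemma space_form_rot a phi u : (phi (rsubmx u) *m (phi (rsubmx u))^T) 0 0 = 1 ->
  space_form rho c (a (lsubmx u 0 0)) -> space_form rho c (rot a phi u).
Proof. by move=> p1; rewrite /space_form/= rot_last form_rot. Qed.

Lemma form_derive_rot a b phi u w :
  differentiable a (lsubmx u 0 0) -> differentiable phi (rsubmx u) ->
  (phi (rsubmx u) *m (phi (rsubmx u))^T) 0 0 = 1 ->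
  'J phi (rsubmx u) *m (phi (rsubmx u))^T = 0 ->
  form rho ('D_w (rot a phi) u) (rot b phi u) =
  lsubmx w 0 0 * form rho (derive1 a (lsubmx u 0 0)) (b (lsubmx u 0 0)).
Proof.
move=> da dp p1 pJ; rewrite (derive_rot w da dp).2 formDl formZl form_rot//.
rewrite /rot form_row_mx !mul0mx [X in _ + (_ + X)]mxE addr0 deriveEjacobian//.
rewrite -scalemxAl linearZ -scalemxAr -mulmxA pJ mulmx0 !scaler0.
by rewrite !mxE addr0.
Qed.
End RotNormal.

Lemma jacobian_near (R : realType) m n (g h : 'rV[R]_m -> 'rV[R]_n) u (e : R) :
  differentiable g u -> differentiable h u -> (\near u, g u = e *: h u) ->
  'J g u = e *: 'J h u.
Proof.
move=> dg dh gh; apply/row_matrixP => i; rewrite !rowE -scalemxAr.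
apply: (etrans (esym (deriveEjacobian (delta_mx 0 i) dg))).
apply: (etrans _ (congr1 ( *:%R e) (deriveEjacobian (delta_mx 0 i) dh))).
rewrite (near_eq_derive _ gh) deriveZ//.
exact: diff_derivable.
Qed.

Section RotHypersurface.
Context {R : realType} (k : nat).
Variables (rho c : R) (I : set R) (gamma nu : R -> 'rV[R]_(1 + 2)).
Hypotheses (oI : open I) (ac : arclength_curve rho c I gamma)
  (cn : curve_normal rho I gamma nu) (x0 : forall s, I s -> gamma s 0 0 != 0).
Variables (V : set 'rV[R]_k) (phi : 'rV[R]_k -> 'rV[R]_(k.+1)).
Hypothesis sp : sphere_patch V phi.

Local Notation U := (rot_dom I V).
Local Notation f := (rot gamma phi).
Local Notation eta0 := (rot nu phi).
Local Notation kappa := (curvature rho gamma nu).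
Local Notation G u := ('J phi (rsubmx u) *m ('J phi (rsubmx u))^T).

Definition parallel_curvature s : R := nu s 0 0 / gamma s 0 0.
Local Notation lam := parallel_curvature.

Lemma rot_dom_facts u : U u ->
  [/\ I (lsubmx u 0 0), V (rsubmx u), differentiable phi (rsubmx u),
   (phi (rsubmx u) *m (phi (rsubmx u))^T) 0 0 = 1 &
   'J phi (rsubmx u) *m (phi (rsubmx u))^T = 0].
Proof.
case=> Is Vv; case: (sp) => -[oV _] sphi p1 _; split=> //.
- exact: smooth_differentiable sphi Vv.
- exact: p1.
- exact: sphere_patch_jacobian sp Vv.
Qed.

Lemma first_ff_rot u : U u -> (first_ff rho f u : 'M[R]_(1 + k)) =
  block_mx 1%:M 0 0 (gamma (lsubmx u 0 0) 0 0 ^+ 2 *: G u).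
Proof.
move=> Uu; have [Is Vv dp p1 pJ] := rot_dom_facts Uu.
have dg := smooth_differentiable ac.1 Is.
by rewrite /first_ff form_jacobian// (ac.2 _ Is).2.
Qed.

Lemma first_ff_unit u : U u -> first_ff rho f u \in unitmx.
Proof.
move=> Uu; have [Is Vv _ _ _] := rot_dom_facts Uu.
have [_ _ _ /(_ _ Vv)/gram_unit] := sp.
rewrite !unitmxE first_ff_rot// det_ublock det1 mul1r detZ unitrM => ->.
by rewrite andbT unitfE expf_neq0// expf_neq0// x0.
Qed.

Definition shape_rot s : 'M[R]_(1 + k) := block_mx (kappa s)%:M 0 0 (- lam s)%:M.

Lemma shape_op_rot u : U u -> shape_op rho f eta0 u = shape_rot (lsubmx u 0 0).
Proof.
move=> Uu; have [Is Vv dp p1 pJ] := rot_dom_facts Uu.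
have dg := smooth_differentiable ac.1 Is.
have dn := smooth_differentiable cn.1 Is.
(* Factoring the second form through the first avoids an explicit inverse of the Gram matrix of
   phi. *)
have second : second_ff rho f eta0 u =
    (first_ff rho f u : 'M[R]_(1 + k)) *m shape_rot (lsubmx u 0 0).
  rewrite /second_ff form_jacobian// first_ff_rot// mulmx_block.
  rewrite !mulmx0 !mul0mx !mul1mx !addr0 !add0r mul_mx_scalar scalerA.
  rewrite [LHS](opp_block_mx) !oppr0 (form_velocity_normal oI ac cn Is).
  congr block_mx; first by rewrite raddfN opprK.
  rewrite -scaleNr; congr (_ *: _); rewrite /parallel_curvature.
  by field; exact: x0.
by rewrite /shape_op second mulKmx// first_ff_unit.
Qed.

Definition mean_rot s : R := (kappa s - k%:R * lam s) / k.+1%:R.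

Lemma mxtrace_shape_rot s : \tr (shape_rot s) / k.+1%:R = mean_rot s.
Proof.
rewrite /shape_rot mxtrace_block !mxtrace_scalar /mean_rot mulNrn.
by rewrite mulr1n mulr_natl.
Qed.

Lemma unit_normal_rot : unit_normal rho U f eta0.
Proof.
case: (sp) => -[oV _] sphi _ _; split; first exact: smooth_rot cn.1 sphi.
move=> u Uu; have [Is Vv dp p1 pJ] := rot_dom_facts Uu.
have [tn n1 gn] := cn.2 _ Is; split.
- by apply/tangent_spaceP; rewrite sf_normal_rot form_rot//; exact/tangent_spaceP.
- by rewrite form_rot.
- move=> v; rewrite form_derive_rot ?gn ?mulr0//.
  exact: smooth_differentiable ac.1 Is.
Qed.

Lemma immersed_rot : immersed_patch rho c U f.
Proof.
case: (sp) => -[oV _] sphi _ _; split.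
- exact: rot_dom_open.
- exact: smooth_rot ac.1 sphi.
- move=> u Uu; have [Is Vv dp p1 pJ] := rot_dom_facts Uu.
  by apply: space_form_rot => //; have [] := ac.2 _ Is.
(* Since J [ambient_mx] J^T is the first form, its inverse yields a right inverse of the Jacobian
   J. *)
- move=> u Uu; apply/row_freeP.
  exists (ambient_mx k.+1 rho *m ('J f u)^T *m invmx (first_ff rho f u)).
  by rewrite !mulmxA mulmxV// first_ff_unit.
Qed.

(** The coordinate vectors, [eta0] and the normal of the space form span the ambient space, and eta
    - e [eta0] is orthogonal to all of them. Then <eta, eta> = 1 gives e^2 = 1. *)
Lemma unit_normal_unique eta u : unit_normal rho U f eta -> U u ->
  eta u = form rho (eta u) (eta0 u) *: eta0 u /\
  form rho (eta u) (eta0 u) ^+ 2 = 1.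
Proof.
move=> [seta etaP] Uu; have [Is Vv dp p1 pJ] := rot_dom_facts Uu.
have [te e1 fe] := etaP u Uu; have [t0 e01 fe0] := unit_normal_rot.2 u Uu.
have dg := smooth_differentiable ac.1 Is.
set e := form rho (eta u) (eta0 u).
have rowJ i : row i ('J f u) = 'D_(delta_mx 0 i) f u.
  by rewrite rowE deriveEjacobian//; have [] := derive_rot 0 dg dp.
have fN w : form rho ('D_w f u) (sf_normal rho (f u)) = 0.
  rewrite sf_normal_rot form_derive_rot// formC.
  by rewrite (tangent_velocity oI ac Is) mulr0.
have E : eta u = e *: eta0 u.
  apply/eqP; rewrite -subr_eq0; apply/eqP.
  apply: (frame_separates (T := 'J f u) (e := eta0 u) (rho := rho)
    (N := sf_normal rho (f u))) => //.
  - exact: first_ff_unit.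
  - by rewrite formC; exact/tangent_spaceP.
  - apply: (form_sf_normal (c := c)); apply: space_form_rot => //.
    by have [] := ac.2 _ Is.
  - by move=> i; rewrite rowJ.
  - by move=> i; rewrite rowJ.
  - by move=> i; rewrite rowJ formDr formNr formZr fe fe0 mulr0 subrr.
  - by rewrite formDr formNr formZr e01 mulr1 formC subrr.
  - have /tangent_spaceP h1 := te; have /tangent_spaceP h2 := t0.
    by rewrite formDr formNr formZr h1 h2 mulr0 subrr.
by split=> //; move: e1; rewrite E formZl formZr e01 mulr1 expr2.
Qed.

(** The factor e is continuous and takes only the values 1 and -1, so two values at distance less
    than 1 coincide. A locally constant sign is enough, because the biconservative equation involves
    only derivatives at a point. *)
Lemma unit_normal_local eta u : unit_normal rho U f eta -> U u ->
  exists2 e : R, e ^+ 2 = 1 & \near u, U u /\ eta u = e *: eta0 u.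
Proof.
move=> un Uu; have oU : open U by apply: rot_dom_open => //; case: sp => -[].
pose e u := form rho (eta u) (eta0 u).
have ce : {for u, continuous e}.
  have C0 : Ck 0 U e :=
    Ck_bilin (ambient_mx k.+1 rho) oU (un.1 0%N) (unit_normal_rot.1 0%N).
  exact: C0.
exists (e u); first by have [] := unit_normal_unique un Uu.
have near_e : \forall v \near u, `|e u - e v| < 1.
  have ce1 : e @ u --> e u := ce.
  by move/cvgrPdist_lt : ce1 => /(_ 1 ltr01).
near=> v.
have Uv : U v by near: v; exact: open_nbhs_nbhs.
split=> //; have [ev /eqP] := unit_normal_unique un Uv.
have [_ /eqP] := unit_normal_unique un Uu.
have : `|e u - e v| < 1 by near: v.
rewrite -/(e v) -/(e u) in ev *; rewrite !sqrf_eq1 => d /orP eu1 /orP ev1.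
rewrite [LHS]ev; congr (_ *: _); move: d.
by case: eu1 => /eqP ->; case: ev1 => /eqP -> //; rewrite ltr_norml; lra.
Unshelve. all: by end_near. Qed.

Lemma shape_op_local eta u : unit_normal rho U f eta -> U u ->
  exists2 e : R, e ^+ 2 = 1 & \near u, U u /\
    (shape_op rho f eta u = e *: shape_rot (lsubmx u 0 0) :> 'M[R]_(1 + k)).
Proof.
(* The Jacobian of eta at a nearby point v requires eta = e [eta0] on a whole neighbourhood of v,
   not just at v. *)
move=> un Uu; have [e e1 /near_join ne] := unit_normal_local un Uu; exists e => //.
near=> v.
have nv : \forall w \near v, U w /\ eta w = e *: eta0 w by near: v.
have [Uv _] := nbhs_singleton nv; split=> //.
rewrite -shape_op_rot// /shape_op scalemxAr; congr (_ *m _).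
rewrite /second_ff (jacobian_near (e := e) (h := eta0) (g := eta)).
- by rewrite linearZ -scalemxAr scalerN.
- exact: smooth_differentiable un.1 Uv.
- exact: smooth_differentiable unit_normal_rot.1 Uv.
- by apply: filterS nv => w [].
Unshelve. all: by end_near. Qed.

Lemma mean_curvature_local eta u : unit_normal rho U f eta -> U u ->
  exists2 e : R, e ^+ 2 = 1 & \near u, U u /\
    mean_curvature rho f eta u = e * mean_rot (left_part (u : 'rV[R]_(1 + k))).
Proof.
move=> un Uu; have [e e1 ne] := shape_op_local un Uu; exists e => //.
apply: filterS ne => v [Uv sv]; split=> //.
by rewrite /mean_curvature sv mxtraceZ -mulrA mxtrace_shape_rot.
Qed.

Lemma smooth_lam : smooth I lam.
Proof.
move=> n; have C i (a : R -> 'rV[R]_(1 + 2)) : smooth I a -> Ck n I (fun s => rV_coord i (a s)).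
  by move=> /(_ n) sa; apply: Ck_linear_comp => //; exact: rV_linear_continuous.
exact: Ck_scale oI (C 0 _ cn.1) (Ck_inv oI x0 (C 0 _ ac.1)).
Qed.

Lemma smooth_mean_rot : smooth I mean_rot.
Proof.
move=> n; have sk := smooth_curvature oI ac cn n; have sl := smooth_lam n.
have Cl := Ck_scale oI (Ck_cst n I (- k%:R : R)) sl.
have := Ck_scale oI (Ck_cst n I (k.+1%:R^-1 : R)) (Ck_add oI sk Cl).
apply: Ck_eq => // s Is; rewrite /mean_rot /= mulrC.
by congr (_ * _); congr (_ + _); rewrite -mulNr.
Qed.

(** Up to the local sign e, H depends on s alone, and s-curves have unit speed and are orthogonal to
    the orbits; so grad H = e h' d/ds and only the first entry of the equation matters. Both terms
    contain e twice, and 2 kappa + (k + 1) h = 3 kappa - k lam. *)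
Lemma biconservative_atP eta u : unit_normal rho U f eta -> U u ->
  biconservative_at rho f eta u <->
  derive1 mean_rot (lsubmx u 0 0) *
    (3%:R * kappa (lsubmx u 0 0) - k%:R * lam (lsubmx u 0 0)) = 0.
Proof.
move=> un Uu; have [Is _ _ _ _] := rot_dom_facts Uu; set s := lsubmx u 0 0.
have dm := smooth_differentiable smooth_mean_rot Is.
have [e e1 ne] := shape_op_local un Uu.
have [_ sv] := nbhs_singleton ne.
have nm : \forall v \near u, mean_curvature rho f eta v =
    (e *: (fun v => mean_rot (left_part (v : 'rV[R]_(1 + k))))) v.
  apply: filterS ne => v [Uv svv].
  by rewrite /mean_curvature svv mxtraceZ -mulrA mxtrace_shape_rot.
have dH i : 'D_(delta_mx 0 i) (mean_curvature rho f eta) u =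
    e * (lsubmx (delta_mx 0 i : 'rV[R]_(1 + k)) 0 0 * derive1 mean_rot s).
  have [dc Dc] := diff_comp_linear (L := @left_part R k) (f := mean_rot) (x := u)
    (@rV_linear_continuous _ _ _ _) dm.
  rewrite (near_eq_derive _ nm) deriveZ; last exact: diff_derivable.
  by rewrite Dc derive_real_dir.
have col : (\col_i 'D_(delta_mx 0 i) (mean_curvature rho f eta) u : 'cV[R]_(1 + k)) =
    col_mx (e * derive1 mean_rot s)%:M 0.
  apply/colP => i; rewrite [LHS]mxE dH -(fintype.splitK i) /unsplit.
  case: (fintype.split i) => j.
    by rewrite col_mxEu !mxE !ord1 /= mul1r.
  by rewrite col_mxEd !mxE /= mul0r mulr0.
have gE : (grad rho f (mean_curvature rho f eta) u : 'cV[R]_(1 + k)) =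
    col_mx (e * derive1 mean_rot s)%:M 0.
  rewrite /grad; have -> : (\col_i 'D_(delta_mx 0 i) (mean_curvature rho f eta) u) =
    first_ff rho f u *m (col_mx (e * derive1 mean_rot s)%:M 0 : 'cV[R]_(1 + k)).
    rewrite (first_ff_rot Uu) mul_block_col !mulmx0 !mul0mx mul1mx !addr0.
    exact: col.
  by rewrite mulKmx// first_ff_unit.
have HE : mean_curvature rho f eta u = e * mean_rot s by exact: nbhs_singleton nm.
rewrite /biconservative_at gE HE sv /shape_rot.
rewrite -scalemxAl mul_block_col !mulmx0 !mul0mx !addr0 !scale_col_mx.
rewrite [X in X = 0 <-> _]add_col_mx !scaler0 addr0 -scalar_mxM !scale_scalar_mx.
rewrite -raddfD /=.
have -> : 2%:R * (e * (kappa s * (e * derive1 mean_rot s))) +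
   k.+1%:R * (e * mean_rot s) * (e * derive1 mean_rot s) =
   derive1 mean_rot s * (3%:R * kappa s - k%:R * lam s).
  transitivity (e ^+ 2 * (derive1 mean_rot s *
     (2%:R * kappa s + k.+1%:R * mean_rot s))); first by ring.
  rewrite e1 mul1r /mean_rot; congr (_ * _).
  by field; rewrite nat1r pnatr_eq0.
split=> [/(congr1 (fun M : 'cV[R]_(1 + k) => M (lshift k 0) 0))|->].
  by rewrite col_mxEu !mxE eqxx mulr1n.
by rewrite raddf0 col_mx0.
Qed.
End RotHypersurface.

(** * Spheres and connectedness *)

Lemma connected_normed (R : realType) (E : normedModType R) : connected [set: E].
Proof.
have -> : [set: E] = \bigcup_(y in setT) ((fun t : R => t *: y) @` `[0, 1]).
  apply/seteqP; split=> // y _; exists y => //; exists 1; last by rewrite scale1r.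
  by rewrite /= in_itv/= ler01 lexx.
apply: bigcup_connected.
  by exists 0 => y _; exists 0; [rewrite /= in_itv/= lexx ler01|rewrite scale0r].
move=> y _; apply: connected_continuous_connected; first exact: segment_connected.
by apply: continuous_subspaceT => t; exact: scalel_continuous.
Qed.

Section SpherePatch.
Context {R : realType} (k : nat).

Let h (v : 'rV[R]_k) : R := 1 + (v *m 1%:M *m v^T) 0 0.
Let pole : 'rV[R]_(1 + k) := inl_mx k 1%:M.

Let h_gt0 v : 0 < h v.
Proof.
rewrite /h mulmx1 mxE ltr_wpDr//; apply: sumr_ge0 => i _.
by rewrite mxE -expr2 sqr_ge0.
Qed.

(** Inverse stereographic projection: 2 / (1 + |v|^2) is the nonzero parameter at which the line
    from the pole through (0, v) meets the sphere. This patch lets hypotheses about all patches be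
    evaluated at any given s. *)
Definition stereographic (v : 'rV[R]_k) : 'rV[R]_(1 + k) :=
  pole + (2%:R / h v) *: (inr_mx 1 v - pole).

Let a (v : 'rV[R]_k) : R := 2%:R / h v.

Let smooth_h n : Ck n [set: 'rV[R]_k] h.
Proof.
apply: Ck_add => //; [exact: openT|exact: Ck_cst|].
apply: Ck_bilin; [exact: openT| |]; by apply: (@Ck_linear R _ _ n setT idfun) => ?.
Qed.

Let smooth_a n : Ck n [set: 'rV[R]_k] a.
Proof.
apply: (Ck_scale openT (Ck_cst n setT (2%:R : R))).
by apply: Ck_inv; [exact: openT|move=> u _; rewrite gt_eqF|exact: smooth_h].
Qed.

Let smooth_w n : Ck n [set: 'rV[R]_k] (fun v => inr_mx 1 v - pole).
Proof.
apply: Ck_add; [exact: openT| |exact: Ck_cst].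
by apply: (@Ck_linear R _ _ n setT (@inr_mx R 1 k)); exact: rV_linear_continuous.
Qed.

Let smooth_stereographic n : Ck n [set: 'rV[R]_k] stereographic.
Proof.
apply: Ck_add; [exact: openT|exact: Ck_cst|].
exact: (Ck_scale openT (smooth_a n) (smooth_w n)).
Qed.

Let norm_stereographic v : (stereographic v *m (stereographic v)^T) 0 0 = 1.
Proof.
rewrite /stereographic -/(a v).
have -> : pole + a v *: (inr_mx 1 v - pole) = row_mx (1 - a v)%:M (a v *: v).
  rewrite /pole /inl_mx /inr_mx opp_row_mx add_row_mx scale_row_mx add_row_mx.
  by rewrite sub0r subr0 add0r scalerN scale_scalar_mx mulr1 -raddfN -raddfD.
rewrite tr_row_mx mul_row_col mxE tr_scalar_mx -scalar_mxM.
have -> : (a v *: v)^T = a v *: v^T by rewrite linearZ.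
rewrite -scalemxAl -scalemxAr scalerA.
have -> : v *m v^T = (h v - 1)%:M.
  by rewrite [LHS]mx11_scalar /h mulmx1 addrC addKr.
rewrite scale_scalar_mx !mxE !mulr1n /a.
by field; rewrite gt_eqF.
Qed.

Lemma stereographic_patch : sphere_patch [set: 'rV[R]_k] stereographic.
Proof.
split.
- split; first exact: openT.
  exact: connected_normed.
- exact: smooth_stereographic.
- by move=> v _; exact: norm_stereographic.
- move=> v _; apply/inj_row_free => w wJ.
  have da : differentiable a v.
    by apply: (smooth_differentiable (U := setT)) => // n; exact: smooth_a.
  have dw : differentiable (fun v => inr_mx 1 v - pole) v.
    by apply: (smooth_differentiable (U := setT)) => // n; exact: smooth_w.
  have ds : differentiable stereographic v.
    by apply: (smooth_differentiable (U := setT)) => // n; exact: smooth_stereographic.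
  have [dp Dp] := diff_scalef da dw.
  have DE : 'D_w stereographic v =
     a v *: inr_mx 1 w + 'D_w a v *: (inr_mx 1 v - pole).
    have dl : differentiable (@inr_mx R 1 k) v.
      by apply: linear_differentiable; exact: rV_linear_continuous.
    rewrite /stereographic deriveD; [|exact: derivable_cst|exact: diff_derivable].
    rewrite derive_cst add0r Dp deriveB; [|exact: diff_derivable|exact: derivable_cst].
    rewrite derive_cst subr0 deriveE// diff_lin//.
    exact: rV_linear_continuous.
  (* The component of the derivative along the pole is minus the derivative of [a]. Once this
     vanishes, the other components reduce to [a v *: w], so w = 0. *)
  have := deriveEjacobian w ds; rewrite wJ DE /pole /inl_mx /inr_mx.
  rewrite opp_row_mx add_row_mx !scale_row_mx add_row_mx.
  rewrite -[RHS](row_mx0 R 1 1 k).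
  move=> /eq_row_mx[/(congr1 (fun M : 'M[R]_1 => M 0 0)) + ].
  rewrite !mxE !mulr1n mulr0 !add0r mulrN1 => /eqP; rewrite oppr_eq0 => /eqP ->.
  rewrite scale0r addr0 => /eqP; rewrite scaler_eq0 => /orP[|/eqP//].
  by rewrite /a mulf_eq0 invr_eq0 !gt_eqF.
Qed.
End SpherePatch.

Section Connectedness.
Context {R : realType}.

(** The level set of f through x is both relatively open and relatively closed in A. No topology on
    Y is involved, so that f may be a Boolean test. *)
Lemma connected_locally_constant (T : topologicalType) Y (A : set T) (f : T -> Y) :
  connected A -> (forall x, A x -> \forall y \near x, A y -> f y = f x) ->
  forall x y, A x -> A y -> f x = f y.
Proof.
move=> cA lc x y Ax Ay.
suff E : A `&` [set z | f z = f x] = A.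
  by have : A y by []; rewrite -[in X in X -> _]E => -[_ ->].
apply: cA; first by exists x.
- exists (interior [set z | A z -> f z = f x]); first exact: open_interior.
  apply/seteqP; split=> z [Az fz]; split=> //.
    by have := lc z Az; rewrite fz.
  by have /= := interior_subset fz; apply.
- exists (~` interior [set z | A z -> f z <> f x]).
    exact/open_closedC/open_interior.
  apply/seteqP; split=> z [Az fz]; split=> //.
    by move=> /interior_subset/(_ Az); apply.
  apply: contrapT => fzx; apply: fz.
  by have := lc z Az; apply: filterS => w /[apply] ->.
Qed.

Lemma derive_0_interval (I : set R) (f : R -> R) : is_interval I ->
  (forall s, I s -> is_derive s 1 f 0) -> forall s t, I s -> I t -> f s = f t.
Proof.
move=> iI f0.
suff H s t : s <= t -> I s -> I t -> f s = f t.
  by move=> s t Is It; case: (leP s t) => [|/ltW] st; [|symmetry]; exact: H.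
move=> st Is It.
have Ix x : s <= x <= t -> I x by move=> xst; exact: iI Is It _ xst.
have [| |x xst] := @MVT_segment R f (cst 0) s t st.
- move=> x; rewrite in_itv/= => /andP[/ltW sx /ltW xt].
  by apply: f0; apply: Ix; rewrite sx.
- apply: derivable_within_continuous => x; rewrite in_itv/= => xst.
  by apply: ex_derive; apply: f0; exact: Ix.
by rewrite mul0r => /eqP; rewrite subr_eq0 => /eqP.
Qed.
End Connectedness.

Section Interval.
Context {R : realType}.

Lemma smooth_lin (I : set R) (f g : R -> R) a b : open I ->
  smooth I f -> smooth I g -> smooth I (fun s => a * f s + b * g s).
Proof.
move=> oI sf sg n; apply: Ck_add => //.
  exact: (Ck_scale oI (Ck_cst n I a) (sf n)).
exact: (Ck_scale oI (Ck_cst n I b) (sg n)).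
Qed.

Lemma derive1_lin (I : set R) (f g : R -> R) a b s : I s ->
  smooth I f -> smooth I g ->
  derive1 (fun s => a * f s + b * g s) s = a * derive1 f s + b * derive1 g s.
Proof.
move=> Is /smooth_is_derive/(_ Is) df /smooth_is_derive/(_ Is) dg.
by apply: is_derive1E; apply: is_deriveD; apply: is_deriveZ.
Qed.

Lemma near_neq0 (f : R -> R) s : {for s, continuous f} -> f s != 0 ->
  \forall t \near s, f t != 0.
Proof.
move=> cf f0; have cf1 : f @ s --> f s := cf.
by move: cf1 => /cvgr_neq0/(_ f0).
Qed.

Lemma smooth_continuous (E F : normedModType R) (U : set E) (f : E -> F) u :
  smooth U f -> U u -> {for u, continuous f}.
Proof. by move=> sf; exact: (sf 0%N). Qed.
End Interval.

(** * Constant mean curvature, the axis of rotation, and the two branches of the equation *)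

Section RotCMC.
Context {R : realType} (k : nat).
Variables (rho c : R) (I : set R) (gamma nu : R -> 'rV[R]_(1 + 2)).
Hypotheses (oI : open I) (iI : is_interval I)
  (ac : arclength_curve rho c I gamma) (cn : curve_normal rho I gamma nu).

Local Notation kappa := (curvature rho gamma nu).
Local Notation lam := (parallel_curvature gamma nu).
Local Notation h := (mean_rot k rho gamma nu).

(** Although h is constant, the mean curvature of a patch equals h only up to the local sign of its
    unit normal. It is thus locally constant, and connectedness of I and of V makes it constant. *)
Lemma cmc_rot : (forall s, I s -> gamma s 0 0 != 0) ->
  (forall s, I s -> derive1 h s = 0) -> cmc rho (@rotational R k I gamma).
Proof.
move=> x0 h0 U f eta [V [phi [sp -> ->]]] un.
have [[oV cV] _ _ _] := sp.
have hc s t : I s -> I t -> h s = h t.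
  apply: derive_0_interval => // r Ir; rewrite -(h0 r Ir).
  apply: (smooth_is_derive (I := I)) => //; exact: (smooth_mean_rot k oI ac cn x0).
pose mc := mean_curvature rho (rot gamma phi) eta.
have lc u : rot_dom I V u -> \forall v \near u, rot_dom I V v /\ mc v = mc u.
  move=> Uu; have [e _ ne] := mean_curvature_local oI ac cn x0 sp un Uu.
  have [_ mu] := nbhs_singleton ne.
  apply: filterS ne => v [Uv mv]; split; first exact: Uv.
  apply: (etrans mv); apply: (etrans _ (esym mu)).
  by congr (_ * _); apply: hc; [exact: Uv.1|exact: Uu.1].
(* Two points of I x V are joined by changing one factor at a time, so that connectedness is applied
   to I and to V separately. *)
pose pt s v : 'rV[R]_(1 + k) := s *: inl_mx k 1%:M + inr_mx 1 v.
have ptE s v : pt s v = row_mx s%:M v.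
  by rewrite /pt /inl_mx /inr_mx scale_row_mx add_row_mx scaler0 add0r addr0 scale_scalar_mx mulr1.
have Upt s v : I s -> V v -> rot_dom I V (pt s v).
  by move=> Is Vv; rewrite ptE /rot_dom/= row_mxKl row_mxKr mxE mulr1n.
have cpl s v : {for s, continuous (pt^~ v)}.
  by apply: cvgD; [exact: scalel_continuous|exact: cvg_cst].
have cpr s v : {for v, continuous (pt s)}.
  have cr := @Ck_linear R _ _ 0 setT _ (@rV_linear_continuous _ _ _ (@inr_mx R 1 k)).
  exact: (Ck_add openT (Ck_cst 0 setT (s *: inl_mx k 1%:M)) cr v Logic.I).
have mc_cst u u' : rot_dom I V u -> rot_dom I V u' -> mc u = mc u'.
  clearbody mc => -[Iu Vu] [Iu' Vu'].
  have mcl v s t : V v -> I s -> I t -> mc (pt s v) = mc (pt t v).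
    move=> Vv; apply: (connected_locally_constant (A := I) (f := fun s => mc (pt s v))).
      exact/connected_intervalP.
    move=> r Ir; have H : \forall t \near r, rot_dom I V (pt t v) /\ mc (pt t v) = mc (pt r v) :=
      cpl r v _ (lc _ (Upt r v Ir Vv)).
    by apply: filterS H => t' [_ mt] _; exact: mt.
  have mcr s v w : I s -> V v -> V w -> mc (pt s v) = mc (pt s w).
    move=> Is; apply: (connected_locally_constant (A := V) (f := fun v => mc (pt s v))) => //.
    move=> r Vr; have H : \forall w \near r, rot_dom I V (pt s w) /\ mc (pt s w) = mc (pt s r) :=
      cpr s r _ (lc _ (Upt s r Is Vr)).
    by apply: filterS H => t' [_ mt] _; exact: mt.
  have e (x : 'rV[R]_(1 + k)) : pt (lsubmx x 0 0) (rsubmx x) = x.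
    by rewrite ptE -mx11_scalar hsubmxK.
  rewrite -(e u) -(e u').
  by rewrite (mcl _ _ (lsubmx u' 0 0))// (mcr _ _ (rsubmx u')).
have [[u0 Uu0]|nU] := pselect (rot_dom I V !=set0); last first.
  by exists 0 => u Uu; exfalso; apply: nU; exists u.
by exists (mc u0) => u Uu; exact: mc_cst.
Qed.

(** On the axis the orbit collapses: the rows of the Jacobian in the sphere directions carry the
    factor x_1, and k > 0 provides at least one such row. *)
Lemma radius_neq0 : (0 < k)%N ->
  immersed_hypersurface rho c (@rotational R k I gamma) ->
  forall s, I s -> gamma s 0 0 != 0.
Proof.
move=> k0 im s Is; apply/negP => /eqP g0.
have sp := stereographic_patch (R := R) k.
have /im[_ _ _ rf] : rotational (k := k) I gamma (rot_dom I setT) (rot gamma (@stereographic R k)).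
  by exists setT, (@stereographic R k).
pose u : 'rV[R]_(1 + k) := row_mx s%:M 0.
have us : lsubmx u 0 0 = s by rewrite row_mxKl mxE mulr1n.
have Uu : rot_dom I setT u by split=> //; rewrite us.
have [Is' _ dp _ _] := rot_dom_facts sp Uu.
have dg := smooth_differentiable ac.1 Is'.
have : (row_mx 0 (const_mx 1) : 'rV[R]_(1 + k)) *m 'J (rot gamma (@stereographic R k)) u = 0.
  rewrite (jacobian_rot dg dp) mul_row_block !mul0mx mulmx0 us g0 scale0r mulmx0.
  by rewrite !addr0 row_mx0.
move=> /eqP; rewrite mulmx_free_eq0; last exact: rf.
rewrite -[X in _ == X](row_mx0 R 1 1 k) => /eqP/eq_row_mx[_].
move=> /(congr1 (fun M : 'rV[R]_k => M 0 (Ordinal k0))); rewrite !mxE => /eqP.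
by rewrite oner_eq0.
Qed.

(** The function (k + 1) h' + 2 kappa' vanishes wherever h' does not. At a zero of h' it equals 2
    kappa' <> 0, hence it is nonzero nearby and h' vanishes there too. So the zero set of h' is
    open; so is its complement in I, and I is connected. *)
Lemma biconservative_dichotomy :
  (forall s, I s -> gamma s 0 0 != 0) ->
  (forall s, I s -> derive1 kappa s != 0) ->
  (forall s, I s -> derive1 h s * (3%:R * kappa s - k%:R * lam s) = 0) ->
  (forall s, I s -> derive1 h s = 0) \/
  (forall s, I s -> 3%:R * kappa s = k%:R * lam s).
Proof.
move=> x0 k0 bi.
have sk := smooth_curvature oI ac cn; have sl := smooth_lam oI ac cn x0.
have sh := smooth_mean_rot k oI ac cn x0; have sh' := smooth_derive1 sh.
have sk' := smooth_derive1 sk.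
have hE s : I s -> k.+1%:R * derive1 h s = derive1 kappa s - k%:R * derive1 lam s.
  move=> Is; have -> : h = fun s => k.+1%:R^-1 * kappa s + (- (k%:R / k.+1%:R)) * lam s.
    by apply/funext => t; rewrite /mean_rot; field; rewrite nat1r pnatr_eq0.
  by rewrite (derive1_lin _ _ Is sk sl); field; rewrite nat1r pnatr_eq0.
have alt s : I s -> derive1 h s = 0 \/ k.+1%:R * derive1 h s + 2%:R * derive1 kappa s = 0.
  move=> Is; have [|h0] := eqVneq (derive1 h s) 0; [by left|right].
  have nh := near_neq0 (smooth_continuous sh' Is) h0.
  (* Where h' <> 0 the other factor 3 kappa - k lam vanishes on a neighbourhood, so its derivative
     is zero as well. *)
  transitivity (derive1 (fun s => 3%:R * kappa s + (- k%:R) * lam s) s).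
    by rewrite (derive1_lin _ _ Is sk sl) hE//; ring.
  rewrite derive1E (near_eq_derive (g := cst (0 : R))) ?derive_cst//.
  near=> t; have ht : derive1 h t != 0 by near: t.
  have It : I t by near: t; exact: open_nbhs_nbhs.
  by have /eqP := bi t It; rewrite mulf_eq0 (negbTE ht)/= mulNr => /eqP.
have lc s : I s -> \forall t \near s, I t -> (derive1 h t == 0) = (derive1 h s == 0).
  move=> Is; case: (eqVneq (derive1 h s) 0) => hs.
    have c0 := smooth_lin k.+1%:R 2%:R oI sh' sk'.
    have n0 : k.+1%:R * derive1 h s + 2%:R * derive1 kappa s != 0.
      by rewrite hs mulr0 add0r mulf_neq0 ?k0// pnatr_eq0.
    apply: filterS (near_neq0 (smooth_continuous c0 Is) n0) => t nt It.
    by apply/eqP; case: (alt t It) => // /eqP; rewrite (negbTE nt).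
  apply: filterS (near_neq0 (smooth_continuous sh' Is) hs) => t ht _.
  exact/negbTE.
have cst := connected_locally_constant ((connected_intervalP I).2 iI) lc.
have [[s0 Is0 hs0]|nh] := pselect (exists2 s, I s & derive1 h s != 0).
  right=> s Is; have hs : derive1 h s != 0 by rewrite (cst s s0 Is Is0).
  have /eqP := bi s Is; rewrite mulf_eq0 (negbTE hs)/= subr_eq0 => /eqP ->.
  by [].
left=> s Is; apply/eqP; apply: contrapT => /negP hs; apply: nh; by exists s.
Unshelve. all: by end_near. Qed.

End RotCMC.

(** * Power energies *)

Section PowerEnergy.
Context {R : realType}.

Lemma is_derive_coord n (I : set R) (a : R -> 'rV[R]_n) i s : smooth I a -> I s ->
  is_derive s 1 (fun t => a t 0 i) (derive1 a s 0 i).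
Proof.
move=> sa Is; have da := smooth_differentiable sa Is.
have [dc Dc] := diff_linear_comp (L := rV_coord i) (@rV_linear_continuous _ _ _ _) da.
apply: DeriveDef; first exact: (diff_derivable (f := fun t => rV_coord i (a t))).
by rewrite derive1E -[RHS]Dc.
Qed.

Lemma powRS (x r : R) : 0 < x -> x `^ r = x * x `^ (r - 1).
Proof.
move=> x0; rewrite -{2}(powRr1 (ltW x0)) -powRD; first by rewrite addrC subrK.
by rewrite (gt_eqF x0) implybT.
Qed.

Lemma is_derive_powR_comp (f : R -> R) (s r df : R) : 0 < f s ->
  is_derive s 1 f df ->
  is_derive s 1 (fun t => f t `^ r) (r * f s `^ (r - 1) * df).
Proof. by move=> f0 fd; exact: (is_derive1_comp (is_derive1_powR r f0) fd). Qed.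

Variables (I : set R) (kappa : R -> R) (p : R).
Hypotheses (oI : open I) (kap0 : forall s, I s -> 0 < kappa s)
  (sk : smooth I kappa).
Local Notation P := (fun x : R => x `^ p).

(** The closed form of P'(kappa), the q of the overview; it is identified with [derive1 P \o kappa]
    on I, where kappa > 0. *)
Definition energy_momentum s : R := p * kappa s `^ (p - 1).
Local Notation q := energy_momentum.
Local Notation dq := (fun s => p * (p - 1) * kappa s `^ (p - 1 - 1) * derive1 kappa s).

Lemma energy_momentumE s : I s -> derive1 P (kappa s) = q s.
Proof. by move=> Is; apply: is_derive1E; apply: is_derive1_powR; exact: kap0. Qed.

Lemma energy_density s : I s -> p * P (kappa s) = kappa s * q s.
Proof. by move=> Is; rewrite /= (powRS p (kap0 Is)) /energy_momentum; ring. Qed.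

Lemma is_derive_energy_density s : I s ->
  is_derive s 1 (fun t => P (kappa t)) (q s * derive1 kappa s).
Proof.
move=> Is; apply: is_derive_powR_comp; first exact: kap0.
exact: smooth_is_derive sk Is.
Qed.

Lemma is_derive_energy_momentum s : I s -> is_derive s 1 q (dq s).
Proof.
move=> Is; have D := is_derive_powR_comp (p - 1) (kap0 Is) (smooth_is_derive sk Is).
by apply: (is_derive_eq (is_deriveZ p D)); rewrite -[_ *: _]/(_ * _) !mulrA.
Qed.

(** Only differentiability is at stake: the value stays symbolic because it is the unknown of the
    Euler-Lagrange equation. *)
Lemma is_derive2_energy_momentum s : I s -> is_derive s 1 dq (derive1 (derive1 q) s).
Proof.
move=> Is; have d1 : derive1 (derive1 q) s = derive1 dq s.
  apply: (derive1_eq_on oI Is) => t It.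
  by apply: is_derive1E; exact: is_derive_energy_momentum.
have D1 := is_derive_powR_comp (p - 1 - 1) (kap0 Is) (smooth_is_derive sk Is).
have D2 := smooth_is_derive (smooth_derive1 sk) Is.
have D3 := is_deriveM (is_deriveZ (p * (p - 1)) D1) D2.
by rewrite d1 (is_derive1E D3).
Qed.

Lemma euler_lagrangeE rho s : I s -> euler_lagrange rho P kappa s <->
  derive1 (derive1 q) s + q s * (kappa s ^+ 2 + rho) - kappa s * P (kappa s) = 0.
Proof.
move=> Is; rewrite /euler_lagrange (energy_momentumE Is).
suff -> : derive1 (derive1 (derive1 P \o kappa)) s = derive1 (derive1 q) s by [].
apply: (derive1_eq_on oI Is) => t It.
by apply: (derive1_eq_on oI It) => r Ir; exact: energy_momentumE.
Qed.

Lemma first_integralE rho s : I s -> first_integral rho P kappa s =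
  dq s ^+ 2 + (kappa s * q s - P (kappa s)) ^+ 2 + rho * q s ^+ 2.
Proof.
move=> Is; rewrite /first_integral (energy_momentumE Is).
have -> : derive1 (derive1 P \o kappa) s = derive1 q s.
  by apply: (derive1_eq_on oI Is) => t It; exact: energy_momentumE.
by rewrite (is_derive1E (is_derive_energy_momentum Is)).
Qed.

End PowerEnergy.

(** Here y, dy, z stand for x_1, x_1', nu_1. Proportionality of q and y is used in the differential
    form q' y = q y', which needs no integration; differentiating once more gives q'' y = q y''. *)
Lemma euler_lagrange_of_linear (R : realType) (k : nat) (rho : R) (I : set R)
    (kappa y dy z : R -> R) (p := k%:R / (k%:R + 3%:R) : R) : (0 < k)%N ->
  open I -> (forall s, I s -> 0 < kappa s) -> smooth I kappa ->
  (forall s, I s -> y s != 0) ->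
  (forall s, I s -> is_derive s 1 y (dy s)) ->
  (forall s, I s -> is_derive s 1 dy (kappa s * z s - rho * y s)) ->
  (forall s, I s -> is_derive s 1 z (- kappa s * dy s)) ->
  (forall s, I s -> 3%:R * kappa s * y s = k%:R * z s) ->
  forall s, I s -> euler_lagrange rho (fun x => x `^ p) kappa s.
Proof.
move=> k0 oI kap0 sk y0 dyP ddyP dzP E s Is.
have [_] := euler_lagrangeE p oI kap0 rho Is; apply.
have kR : (k%:R : R) != 0 by rewrite pnatr_eq0 -lt0n.
have k3 : (k%:R : R) + 3%:R != 0 by rewrite -natrD pnatr_eq0 addn3.
have Dk t : I t -> derive1 kappa t * y t = - ((k%:R + 3%:R) / 3%:R) * (kappa t * dy t).
  move=> It.
  have D1 := is_deriveM (is_deriveZ (3%:R : R) (smooth_is_derive sk It)) (dyP t It).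
  have D2 := is_deriveZ (k%:R : R) (dzP t It).
  have : derive1 ((3%:R \*: kappa) * y) t = derive1 (k%:R \*: z) t.
    by apply: (derive1_eq_on oI It) => r Ir; exact: E.
  rewrite (is_derive1E D1) (is_derive1E D2) /= -![_ *: _]/(_ * _) => h.
  have {h} : 3%:R * (derive1 kappa t * y t) = - (k%:R + 3%:R) * (kappa t * dy t).
    by transitivity (k%:R * (- kappa t * dy t) - 3%:R * kappa t * dy t); [rewrite -h; ring|ring].
  by move=> h; apply: (mulfI (x := 3%:R)); rewrite ?pnatr_eq0// h; field.
set q := energy_momentum kappa p.
pose dq t := p * (p - 1) * kappa t `^ (p - 1 - 1) * derive1 kappa t.
have qy t : I t -> dq t * y t = q t * dy t.
  move=> It; rewrite /dq /q /energy_momentum (powRS (p - 1) (kap0 t It)).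
  rewrite -mulrA Dk// /p; field.
  by rewrite k3.
have Dq t : I t -> is_derive t 1 q (dq t) by exact: is_derive_energy_momentum.
have Ddq := is_derive2_energy_momentum p oI kap0 sk Is.
have qy2 : derive1 (derive1 q) s * y s = q s * (kappa s * z s - rho * y s).
  have D1 := is_deriveM Ddq (dyP s Is).
  have D2 := is_deriveM (Dq s Is) (ddyP s Is).
  have := derive1_eq_on oI Is qy.
  rewrite (is_derive1E D1) (is_derive1E D2) -![_ *: _]/(_ * _) -/(dq s) => h.
  apply: (addrI (dq s * dy s)); rewrite -[LHS]/(dq s * dy s + derive1 (derive1 q) s * y s).
  rewrite [X in _ + X]mulrC [RHS]addrC h.
  by rewrite (mulrC (dy s)).
(* After multiplication by y and substitution of z and P, the equation reduces to 3/k + 1 - 1/p =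
   0. *)
apply: (mulIf (y0 s Is)); rewrite mul0r !mulrBl mulrDl qy2.
have -> : kappa s `^ p = kappa s * q s / p.
  rewrite -(energy_density p kap0 Is) mulrC mulKf//.
  by rewrite /p mulf_neq0// invr_eq0.
have -> : z s = 3%:R * kappa s * y s / k%:R by rewrite E// mulrC mulKf.
by rewrite /p; field; rewrite kR k3.
Qed.

(** * Isometries *)

Section Isometry.
Context {R : realType}.
Variables (rho c : R) (I : set R) (gamma nu : R -> 'rV[R]_(1 + 2)).
Hypotheses (oI : open I) (ac : arclength_curve rho c I gamma)
  (cn : curve_normal rho I gamma nu).
Variables (A : 'M[R]_(1 + 2)) (b : 'rV[R]_(1 + 2)).
Hypotheses (AJ : A *m ambient_mx 1 rho *m A^T = ambient_mx 1 rho)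
  (sfA : forall x, space_form rho c x -> space_form rho c (x *m A + b))
  (tA : forall x y, tangent_space rho x y -> tangent_space rho (x *m A + b) (y *m A)).

Let T (x : 'rV[R]_(1 + 2)) := x *m A + b.

Lemma smooth_mulmxr (a : R -> 'rV[R]_(1 + 2)) : smooth I a ->
  smooth I (fun s => a s *m A).
Proof.
by move=> sa n; apply: (Ck_linear_comp (L := mulmxr A)) => //; exact: rV_linear_continuous.
Qed.

Lemma derive1_mulmxr (a : R -> 'rV[R]_(1 + 2)) s : smooth I a -> I s ->
  derive1 (fun s => a s *m A) s = derive1 a s *m A.
Proof.
move=> sa Is; rewrite !derive1E.
have [_ D] := diff_linear_comp (L := mulmxr A) (@rV_linear_continuous _ _ _ _)
  (smooth_differentiable sa Is).
exact: D.
Qed.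

Lemma derive1_isometry s : I s -> derive1 (T \o gamma) s = derive1 gamma s *m A.
Proof.
move=> Is; rewrite -(derive1_mulmxr ac.1 Is) !derive1E.
rewrite deriveD; [by rewrite derive_cst addr0| |exact: derivable_cst].
by apply: diff_derivable; apply: smooth_differentiable (smooth_mulmxr ac.1) Is.
Qed.

Lemma arclength_isometry : arclength_curve rho c I (T \o gamma).
Proof.
split=> [n|s Is].
  by apply: Ck_add => //; [exact: smooth_mulmxr ac.1 n|exact: Ck_cst].
have [sf g1] := ac.2 _ Is; split; first exact: sfA.
by rewrite derive1_isometry// form_mulmx.
Qed.

(** The normal is transported along with the curve, so the signed curvature is kept even if A
    reverses orientation. *)
Lemma normal_isometry : curve_normal rho I (T \o gamma) (fun s => nu s *m A).
Proof.
split=> [|s Is]; first exact: smooth_mulmxr cn.1.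
have [tn n1 gn] := cn.2 _ Is; split; first exact: tA.
  by rewrite form_mulmx.
by rewrite derive1_isometry// form_mulmx.
Qed.

Lemma curvature_isometry s : I s ->
  curvature rho (T \o gamma) (fun s => nu s *m A) s = curvature rho gamma nu s.
Proof.
move=> Is; rewrite /curvature.
rewrite (derive1_eq_on oI Is derive1_isometry) derive1_mulmxr ?form_mulmx//.
exact: smooth_derive1 ac.1.
Qed.
End Isometry.

(** * A reflection that carries a unit vector to the first coordinate axis, up to sign *)

Section Reflection.
Context {R : realType}.
Variables (rho c : R) (w : 'rV[R]_(1 + 2)).
Hypotheses (w1 : form rho w w = 1) (tw : rho = 0 -> w 0 (last_idx 1) = 0).
Local Notation J := (ambient_mx 1 rho).

Let e0 : 'rV[R]_(1 + 2) := delta_mx 0 0.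

(* Choosing the sign so that sg * w_0 <= 0 makes e0 - sg w spacelike. *)
Definition reflection_sign : R := if w 0 0 <= 0 then 1 else -1.
Local Notation sg := reflection_sign.
Let m : R := 1 - sg * w 0 0.
Let v := e0 - sg *: w.

(** Reflection in the hyperplane orthogonal to v = e0 - sg w, which exchanges e0 and sg w. Since <v,
    v> = 2 m, the usual factor 2 / <v, v> is 1 / m. *)
Definition reflection_mx : 'M[R]_(1 + 2) := 1%:M - m^-1 *: (J *m v^T *m v).
Local Notation A := reflection_mx.

Lemma reflection_sign2 : sg ^+ 2 = 1.
Proof. by rewrite /sg; case: ifP; rewrite ?sqrrN expr1n. Qed.

Let m_ge1 : 1 <= m.
Proof. by rewrite /m /sg; case: (lerP (w 0 0) 0); lra. Qed.

Let m_gt0 : 0 < m. Proof. by apply: lt_le_trans m_ge1. Qed.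
Let m_neq0 : m != 0. Proof. by rewrite gt_eqF. Qed.

Lemma form_e0 x : form rho x e0 = x 0 0.
Proof.
rewrite formE (bigD1 0)//= big1 ?addr0 => [|i /negbTE i0].
  by rewrite !mxE !eqxx andbF mul1r mulr1.
by rewrite [e0 _ _]mxE i0 andbF !mulr0.
Qed.

Lemma form_v x : form rho x v = x 0 0 - sg * form rho x w.
Proof. by rewrite /v formDr formNr formZr form_e0. Qed.

Lemma form_vv : form rho v v = 2%:R * m.
Proof.
rewrite form_v /v formDl formNl formZl w1 formC form_e0 !mxE eqxx /= /m.
have := reflection_sign2; rewrite /m => s2; rewrite mulr1n; ring: s2.
Qed.

Lemma reflectionE x : x *m A = x - (form rho x v / m) *: v.
Proof.
rewrite /A mulmxBr mulmx1 -scalemxAr !mulmxA [x *m J *m v^T]mx11_scalar.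
by rewrite mul_scalar_mx scalerA [_ * m^-1]mulrC.
Qed.

Lemma form_reflection x y : form rho (x *m A) (y *m A) = form rho x y.
Proof.
rewrite !reflectionE; move: form_vv; generalize v => z zz.
rewrite !(formDl, formDr, formNl, formNr, formZl, formZr) zz (formC _ z y).
by field.
Qed.

Lemma reflection_isometry : A *m J *m A^T = J.
Proof.
apply/matrixP => i j; rewrite form_mx !rowE form_reflection -!row1 -form_mx.
by rewrite mul1mx trmx1 mulmx1.
Qed.

Lemma reflection_coord0 x : (x *m A) 0 0 = sg * form rho x w.
Proof.
by rewrite reflectionE !mxE eqxx /= mulr1n form_v -/m mulfVK// subKr.
Qed.

Lemma reflection_last (x : 'rV[R]_(1 + 2)) : rho = 0 ->
  (x *m A) 0 (last_idx 1) = x 0 (last_idx 1).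
Proof.
move=> r0; rewrite reflectionE !mxE tw// mulr0 subr0 /= mulr0 subr0.
by [].
Qed.

(** Let t > 0 and u be the time coordinates. If u <= 0, then <x, y> < 0 reads x0 y0 + x1 y1 < t u <=
    0, so (t u)^2 < (x0 y0 + x1 y1)^2. By Cauchy-Schwarz the right side is at most t^2 u^2, as x and
    y are time-like. *)
Lemma timelike_form_lt0 (x y : 'rV[R]_(1 + 2)) : rho < 0 ->
  form rho x x < 0 -> form rho y y < 0 -> form rho x y < 0 ->
  0 < x 0 (last_idx 1) -> 0 < y 0 (last_idx 1).
Proof.
move=> r0; rewrite !formE !big_ord_recl !big_ord0 !mxE !eqxx r0 /= !mulr1n.
have -> : last_idx 1 = lift ord0 (lift ord0 ord0) by exact: val_inj.
move: (x 0 ord0) (x 0 (lift ord0 ord0)) (x 0 (lift ord0 (lift ord0 ord0))) => x0 x1 t.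
move: (y 0 ord0) (y 0 (lift ord0 ord0)) (y 0 (lift ord0 (lift ord0 ord0))) => y0 y1 u.
rewrite !addr0 !mul1r !mulN1r => xx yy xy t0.
rewrite ltNge; apply/negP => u0.
have S0 : 0 <= - (t * u) by nra.
have Sxy : (t * u) ^+ 2 < (x0 * y0 + x1 * y1) ^+ 2.
  by rewrite -sqrrN -(sqrrN (x0 * _ + _)) ltr_pXn2r ?nnegrE//; lra.
have CS : (x0 * y0 + x1 * y1) ^+ 2 <= (x0 ^+ 2 + x1 ^+ 2) * (y0 ^+ 2 + y1 ^+ 2).
  have := sqr_ge0 (x0 * y1 - x1 * y0); nra.
have : (x0 ^+ 2 + x1 ^+ 2) * (y0 ^+ 2 + y1 ^+ 2) <= t ^+ 2 * u ^+ 2.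
  by apply: ler_pM; rewrite ?addr_ge0 ?sqr_ge0//; lra.
by rewrite -exprMn leNgt (lt_le_trans Sxy CS).
Qed.

(* If rho < 0 then <x, x A> <= <x, x> < 0, so x A stays in the sheet of x. *)
Lemma reflection_space_form x : rho != 0 -> space_form rho c x ->
  space_form rho c (x *m A).
Proof.
rewrite /space_form/= => r0; rewrite (negbTE r0) form_reflection => -[xx xl].
split=> // rn; have xn : form rho x x < 0 by rewrite xx invr_lt0.
apply: (timelike_form_lt0 rn xn _ _ (xl rn)); first by rewrite form_reflection.
rewrite reflectionE formDr formNr formZr.
have : 0 <= form rho x v / m * form rho x v.
  by rewrite mulrAC -expr2 divr_ge0 ?sqr_ge0// ltW.
lra.
Qed.
End Reflection.

(** * The conserved vector and the two implications *)

Section RotBiconservative.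
Context {R : realType} (k : nat).
Variables (rho c : R) (I : set R) (gamma nu : R -> 'rV[R]_(1 + 2)).
Hypotheses (oI : open I) (ac : arclength_curve rho c I gamma)
  (cn : curve_normal rho I gamma nu) (x0 : forall s, I s -> gamma s 0 0 != 0).

Local Notation kappa := (curvature rho gamma nu).
Local Notation lam := (parallel_curvature gamma nu).
Local Notation h := (mean_rot k rho gamma nu).

Lemma biconservative_rotP : biconservative rho (@rotational R k I gamma) <->
  forall s, I s -> derive1 h s * (3%:R * kappa s - k%:R * lam s) = 0.
Proof.
split=> [bi s Is|bi U f eta [V [phi [sp -> ->]]] un u Uu]; last first.
  by apply/(biconservative_atP oI ac cn x0 sp un Uu); apply: bi; exact: Uu.1.
(* The scalar equation depends on s alone, so one patch, evaluated at the point (s, 0), suffices. *)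
have sp := stereographic_patch (R := R) k.
pose u : 'rV[R]_(1 + k) := row_mx s%:M 0.
have us : lsubmx u 0 0 = s by rewrite row_mxKl mxE mulr1n.
have Uu : rot_dom I setT u by split=> //; rewrite us.
have un := unit_normal_rot oI ac cn sp.
have /bi/(_ un u Uu) : rotational (k := k) I gamma (rot_dom I setT)
    (rot gamma (@stereographic R k)).
  by exists setT, (@stereographic R k).
by move/(biconservative_atP oI ac cn x0 sp un Uu); rewrite us.
Qed.

Lemma immersed_rotational :
  immersed_hypersurface rho c (@rotational R k I gamma).
Proof.
by move=> U f [V [phi [sp -> ->]]]; exact: immersed_rot oI ac x0 _ _ sp.
Qed.

(** If the mean curvature were a constant l, then (k + 1) l = kappa - k lam = - 2 kappa, and kappa
    would be constant. *)
Lemma not_cmc_rot s : I s -> derive1 kappa s != 0 ->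
  (forall t, I t -> 3%:R * kappa t = k%:R * lam t) ->
  ~ cmc rho (@rotational R k I gamma).
Proof.
move=> Is k0 E cm; have sp := stereographic_patch (R := R) k.
have un := unit_normal_rot oI ac cn sp.
have /cm/(_ un)[l lP] : rotational (k := k) I gamma (rot_dom I setT)
    (rot gamma (@stereographic R k)).
  by exists setT, (@stereographic R k).
have kE t : I t -> kappa t = - (k.+1%:R * l) / 2%:R.
  move=> It; pose u : 'rV[R]_(1 + k) := row_mx t%:M 0.
  have us : lsubmx u 0 0 = t by rewrite row_mxKl mxE mulr1n.
  have Uu : rot_dom I setT u by split=> //; rewrite us.
  have := lP u Uu; rewrite /mean_curvature (shape_op_rot oI ac cn x0 sp Uu).
  rewrite mxtrace_shape_rot us /mean_rot -E// => <-.
  by field; rewrite nat1r pnatr_eq0.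
move: k0; rewrite (derive1_eq_on (g := cst (- (k.+1%:R * l) / 2%:R)) oI Is kE).
by rewrite derive1_cst eqxx.
Qed.
End RotBiconservative.

Section ConservedVector.
Context {R : realType}.
Variables (rho c p : R) (I : set R) (gamma nu : R -> 'rV[R]_(1 + 2)).
Hypotheses (oI : open I) (iI : is_interval I) (ac : arclength_curve rho c I gamma)
  (cn : curve_normal rho I gamma nu).
Local Notation kappa := (curvature rho gamma nu).
Hypothesis kap0 : forall s, I s -> 0 < kappa s.
Local Notation q := (energy_momentum kappa p).
Local Notation P := (fun x : R => x `^ p).
Let dq s := p * (p - 1) * kappa s `^ (p - 1 - 1) * derive1 kappa s.
Hypothesis EL : forall s, I s -> euler_lagrange rho P kappa s.

Definition conserved_vector s : 'rV[R]_(1 + 2) :=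
  dq s *: derive1 gamma s + (P (kappa s) - kappa s * q s) *: nu s
    + (rho * q s) *: gamma s.
Local Notation W := conserved_vector.

Lemma conserved_vector_cst s t : I s -> I t -> W s = W t.
Proof.
have sk := smooth_curvature oI ac cn.
move=> Is It; apply/rowP => i.
apply: (derive_0_interval (f := fun s => W s 0 i) iI _ Is It) => {Is It t} {}s Is.
have Dg := is_derive_coord i ac.1 Is.
have Dg' := is_derive_coord i (smooth_derive1 ac.1) Is.
have Dn := is_derive_coord i cn.1 Is.
have Dk := smooth_is_derive sk Is.
have Dq : is_derive s 1 q (dq s) := is_derive_energy_momentum p kap0 sk Is.
have Ddq : is_derive s 1 dq _ := is_derive2_energy_momentum p oI kap0 sk Is.
have DP := is_derive_energy_density p kap0 sk Is.
have D := is_deriveD (is_deriveD (is_deriveM Ddq Dg')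
  (is_deriveM (is_deriveB DP (is_deriveM Dk Dq)) Dn))
  (is_deriveM (is_deriveZ rho Dq) Dg).
have [+ _] := euler_lagrangeE p oI kap0 rho Is; move=> /(_ (EL Is)) el.
have fE : (fun s => W s 0 i) = dq * (fun t => derive1 gamma t 0 i) +
    ((fun t => P (kappa t)) - kappa * q) * (fun t => nu t 0 i) +
    (rho \*: q) * (fun t => gamma t 0 i).
  by apply/funext => t; rewrite /W !mxE.
rewrite fE; apply: (is_derive_eq D).
rewrite (frenet_velocity oI ac cn Is) (frenet_normal oI ac cn Is) !mxE.
rewrite -![_ *: _]/(_ * _).
have -> : ((fun t => P (kappa t)) - kappa * q) s = P (kappa s) - kappa s * q s by [].
have -> : (rho \*: q) s = rho * q s by [].
(* In W' the coefficients of nu and gamma cancel, and that of gamma' is the left side of the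
   Euler-Lagrange equation. *)
rewrite -[RHS](mulr0 (derive1 gamma s 0 i)) -el /=; ring.
Qed.

(** In W the position vector occurs with the factor rho, so these weighted relations give the
    products of W uniformly in rho. *)
Lemma rho_form_gamma_velocity s : I s -> rho * form rho (gamma s) (derive1 gamma s) = 0.
Proof.
move=> Is; have := tangent_velocity oI ac Is; rewrite form_sf_normalE.
by case: eqP => [->|_ ->]; rewrite ?mul0r ?mulr0.
Qed.

Lemma rho_form_gamma_normal s : I s -> rho * form rho (gamma s) (nu s) = 0.
Proof.
move=> Is; have [/tangent_spaceP + _ _] := cn.2 _ Is; rewrite form_sf_normalE.
by case: eqP => [->|_ ->]; rewrite ?mul0r ?mulr0.
Qed.

Lemma rho_form_gamma s : I s -> rho * (rho * form rho (gamma s) (gamma s)) = rho.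
Proof.
move=> Is; have [+ _] := ac.2 _ Is; rewrite /space_form/=.
by case: eqP => [->|/eqP r0 [-> _]]; rewrite ?mul0r// mulfV// mulr1.
Qed.

Lemma form_conserved_velocity s : I s -> form rho (W s) (derive1 gamma s) = dq s.
Proof.
move=> Is; have [_ g1] := ac.2 _ Is; have [_ n1 gn] := cn.2 _ Is.
rewrite /W !formDl !formZl g1 (formC _ (nu s)) gn.
have := rho_form_gamma_velocity Is => h.
by rewrite mulr0 addr0 mulr1 mulrAC h mul0r addr0.
Qed.

Lemma form_conserved_normal s : I s ->
  form rho (W s) (nu s) = P (kappa s) - kappa s * q s.
Proof.
move=> Is; have [_ g1] := ac.2 _ Is; have [_ n1 gn] := cn.2 _ Is.
rewrite /W !formDl !formZl gn n1.
by rewrite mulr0 add0r mulr1 mulrAC rho_form_gamma_normal// mul0r addr0.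
Qed.

Lemma form_conserved_vector s : I s ->
  form rho (W s) (W s) = first_integral rho P kappa s.
Proof.
move=> Is; have sk := smooth_curvature oI ac cn.
rewrite {2}/W !formDr !formZr form_conserved_velocity// form_conserved_normal//.
rewrite (first_integralE p oI kap0 sk rho Is) -/(dq s).
suff -> : rho * q s * form rho (W s) (gamma s) = rho * q s ^+ 2 by ring.
rewrite /W !formDl !formZl (formC _ (derive1 gamma s)) (formC _ (nu s)).
have := rho_form_gamma_velocity Is; have := rho_form_gamma_normal Is.
have := rho_form_gamma Is.
set a := form _ _ _; set b := form _ _ _; set d := form _ _ _ => ra rb rd.
transitivity (q s ^+ 2 * (rho * (rho * a)) +
   q s * dq s * (rho * d) + q s * (P (kappa s) - kappa s * q s) * (rho * b)).
  by ring.
by rewrite ra rb rd; ring.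
Qed.

(** As W is constant, the derivative of <W, gamma> is <W, gamma'> = q'. *)
Lemma conserved_potential s t : I s -> I t ->
  form rho (W s) (gamma s) - q s = form rho (W t) (gamma t) - q t.
Proof.
move=> Is It; have sk := smooth_curvature oI ac cn.
rewrite (conserved_vector_cst Is It).
apply: (derive_0_interval (f := fun s => form rho (W t) (gamma s) - q s) iI _ Is It).
move=> {Is}r Ir.
have sc : smooth I (cst (W t)) by move=> n; exact: Ck_cst.
have D1 := smooth_is_derive (smooth_form rho oI sc ac.1) Ir.
have Dq : is_derive r 1 q (dq r) := is_derive_energy_momentum p kap0 sk Ir.
apply: (is_derive_eq (is_deriveB D1 Dq)).
rewrite (derive_form rho sc ac.1 Ir) derive1_cst form0l add0r /= (conserved_vector_cst It Ir).
by rewrite form_conserved_velocity// subrr.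
Qed.

Lemma conserved_potential0 s : rho != 0 -> I s ->
  form rho (W s) (gamma s) - q s = 0.
Proof.
move=> r0 Is; rewrite /W !formDl !formZl (formC _ (derive1 gamma s)) (formC _ (nu s)).
have /eqP := rho_form_gamma_velocity Is; have /eqP := rho_form_gamma_normal Is.
rewrite !mulf_eq0 (negbTE r0) /= => /eqP -> /eqP ->.
have /(mulfI r0)/eqP := etrans (rho_form_gamma Is) (esym (mulr1 rho)).
by move=> /eqP rg; rewrite !mulr0 !add0r mulrAC rg mul1r subrr.
Qed.

Lemma conserved_vector_last s : rho = 0 -> I s -> W s 0 (last_idx 1) = 0.
Proof.
move=> r0 Is; have := tangent_velocity oI ac Is.
have [/tangent_spaceP + _ _] := cn.2 _ Is.
rewrite !form_sf_normalE r0 eqxx !mxE => -> ->.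
by rewrite r0 !mul0r !mulr0 !addr0.
Qed.

End ConservedVector.

(** * The two implications and their combination *)

Lemma biconservative_euler_lagrange (R : realType) (k : nat) (rho c : R)
    (I : set R) (gamma nu : R -> 'rV[R]_(1 + 2))
    (kappa := curvature rho gamma nu) (M := @rotational R k I gamma)
    (p := k%:R / (k%:R + 3%:R) : R) :
  (0 < k)%N -> open I -> is_interval I ->
  arclength_curve rho c I gamma -> curve_normal rho I gamma nu ->
  (forall s, I s -> 0 < kappa s) -> (forall s, I s -> derive1 kappa s != 0) ->
  immersed_hypersurface rho c M -> ~ cmc rho M -> biconservative rho M ->
  forall s, I s -> euler_lagrange rho (fun x => x `^ p) kappa s.
Proof.
move=> k0 oI iI ac cn kap0 dkap0 im ncmc.
have x0 := radius_neq0 ac k0 im.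
move=> /(biconservative_rotP k oI ac cn x0).
move=> /(biconservative_dichotomy oI iI ac cn x0 dkap0)[h0|E].
  by exfalso; apply: ncmc; exact: (cmc_rot oI iI ac cn x0 h0).
have sk := smooth_curvature oI ac cn.
apply: (euler_lagrange_of_linear (y := fun s => gamma s 0 0)
  (dy := fun s => derive1 gamma s 0 0) (z := fun s => nu s 0 0)) => // s Is.
- exact: is_derive_coord ac.1 Is.
- have := is_derive_coord 0 (smooth_derive1 ac.1) Is.
  by rewrite (frenet_velocity oI ac cn Is) !mxE.
- have := is_derive_coord 0 cn.1 Is.
  by rewrite (frenet_normal oI ac cn Is) !mxE.
- by rewrite E// /parallel_curvature -mulrA divfK// x0.
Qed.

(** The Euler-Lagrange equation sees gamma only through kappa, which isometries preserve, whereas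
    the rotations are tied to the coordinate x_1. Hence the curve has to be moved by some T before
    it is rotated. *)
Lemma euler_lagrange_biconservative (R : realType) (k : nat) (rho c : R)
    (I : set R) (gamma nu : R -> 'rV[R]_(1 + 2))
    (kappa := curvature rho gamma nu)
    (p := k%:R / (k%:R + 3%:R) : R) (P := fun x : R => x `^ p)
    (M := fun g : R -> 'rV[R]_(1 + 2) => @rotational R k I g) :
  (0 < k)%N -> open I -> is_interval I -> I !=set0 ->
  arclength_curve rho c I gamma -> curve_normal rho I gamma nu ->
  (forall s, I s -> 0 < kappa s) -> (forall s, I s -> derive1 kappa s != 0) ->
  (forall s, I s -> euler_lagrange rho P kappa s) ->
  (rho < 0 -> forall s, I s -> 0 < first_integral rho P kappa s) ->
  exists T : 'rV[R]_(1 + 2) -> 'rV[R]_(1 + 2),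
    [/\ space_form_isometry rho c T,
        immersed_hypersurface rho c (M (T \o gamma)),
        ~ cmc rho (M (T \o gamma)) & biconservative rho (M (T \o gamma))].
Proof.
move=> k0 oI iI [s0 Is0] ac cn kap0 dkap0 EL FI.
have kR : (k%:R : R) != 0 by rewrite pnatr_eq0 -lt0n.
have k3 : (k%:R : R) + 3%:R != 0 by rewrite -natrD pnatr_eq0 addn3.
have p0 : 0 < p by rewrite /p divr_gt0 ?addr_gt0 ?ltr0n.
have sk := smooth_curvature oI ac cn.
pose q := energy_momentum kappa p.
have q0 s : I s -> 0 < q s by move=> Is; rewrite mulr_gt0// powR_gt0// kap0.
have PE s : I s -> P (kappa s) = kappa s * q s / p.
  by move=> Is; rewrite -(energy_density p kap0 Is) mulrC mulKf// gt_eqF.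
have PqE s : I s -> P (kappa s) - kappa s * q s = 3%:R * kappa s * q s / k%:R.
  by move=> Is; rewrite PE// /p; field; rewrite kR k3.
set W := conserved_vector rho p gamma nu s0.
have WE s : I s -> conserved_vector rho p gamma nu s = W.
  by move=> Is; exact: (conserved_vector_cst oI iI ac cn kap0 EL Is Is0).
have D0 : 0 < form rho W W.
  rewrite (form_conserved_vector p oI ac cn kap0 Is0).
  have [r0|r0] := ltP rho 0; first exact: FI.
  rewrite (first_integralE p oI kap0 sk rho Is0).
  (* For rho >= 0 all three terms are nonnegative, and the middle one is positive because P - kappa
     q = 3 kappa q / k > 0. *)
  apply: ltr_wpDr; first by rewrite mulr_ge0 ?sqr_ge0.
  apply: ltr_wpDl; first exact: sqr_ge0.
  rewrite lt_def sqr_ge0 andbT sqrf_eq0 -oppr_eq0 opprB.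
  rewrite (PqE _ Is0); apply: lt0r_neq0.
  have := kap0 _ Is0; have := q0 _ Is0 => qs0 ks0.
  have k0R : 0 < k%:R :> R by rewrite ltr0n.
  exact: (divr_gt0 (mulr_gt0 (mulr_gt0 (ltr0Sn R 2) ks0) qs0) k0R).
set N := Num.sqrt (form rho W W).
have N0 : 0 < N by rewrite sqrtr_gt0.
have N2 : N ^+ 2 = form rho W W by rewrite sqr_sqrtr// ltW.
pose w := N^-1 *: W.
have w1 : form rho w w = 1.
  by rewrite /w formZl formZr -N2; field; rewrite gt_eqF.
have tw : rho = 0 -> w 0 (last_idx 1) = 0.
  by move=> r0; rewrite /w mxE (conserved_vector_last p oI ac cn r0 Is0) mulr0.
pose A := reflection_mx rho w; pose sg := reflection_sign w.
have sg2 : sg ^+ 2 = 1 by exact: reflection_sign2.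
have sg0 : sg != 0 by rewrite -sqrf_eq0 sg2 oner_eq0.
pose X := form rho W (gamma s0) - q s0.
(* After the reflection the first coordinate of gamma is sg <W, gamma> / N = sg (q + X) / N. This
   translation along the first axis removes X, which is zero unless rho = 0. *)
pose b : 'rV[R]_(1 + 2) := - (sg * X / N) *: delta_mx 0 0.
have b0 : rho != 0 -> b = 0.
  move=> r0; rewrite /b /X (conserved_potential0 p oI ac cn r0 Is0).
  by rewrite mulr0 mul0r oppr0 scale0r.
have bl : b 0 (last_idx 1) = 0 by rewrite /b !mxE /= mulr0.
have AJ := reflection_isometry w1 : A *m ambient_mx 1 rho *m A^T = _.
have sfA x : space_form rho c x -> space_form rho c (x *m A + b).
  have [r0|r0] := eqVneq rho 0.
    rewrite /space_form/=; case: eqP => // _ <-.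
    by rewrite mxE bl addr0 (reflection_last tw x r0).
  by rewrite (b0 r0) addr0; exact: (reflection_space_form w1 r0).
have tA x y : tangent_space rho x y -> tangent_space rho (x *m A + b) (y *m A).
  have [r0|r0] := eqVneq rho 0.
    rewrite /tangent_space/=; case: eqP => // _ <-.
    by rewrite (reflection_last tw y r0).
  by rewrite (b0 r0) addr0 /tangent_space/= (negbTE r0) form_mulmx.
pose T := fun x : 'rV[R]_(1 + 2) => x *m A + b.
have ac' := arclength_isometry oI ac AJ sfA.
have cn' := normal_isometry oI ac cn AJ tA.
have kE := curvature_isometry nu oI ac b AJ.
have xE s : I s -> (T (gamma s)) 0 0 = sg * q s / N.
  move=> Is; rewrite /T mxE reflection_coord0 formC formZl -/sg.
  have := conserved_potential oI iI ac cn kap0 EL Is Is0; rewrite -/W WE// -/q -/X => XE.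
  rewrite !mxE eqxx /= mulr1n -XE; field; exact: lt0r_neq0.
have nE s : I s -> (nu s *m A) 0 0 = sg * (3%:R * kappa s * q s / k%:R) / N.
  move=> Is; rewrite reflection_coord0 formC formZl -/sg.
  rewrite -(WE s Is) (form_conserved_normal p ac cn Is) PqE//.
  by rewrite mulrCA mulrC.
have x0 s : I s -> (T \o gamma) s 0 0 != 0.
  move=> Is; rewrite /= (xE s Is); have /lt0r_neq0 qs0 := q0 s Is.
  by rewrite (mulf_neq0 (mulf_neq0 sg0 qs0)) ?invr_eq0// lt0r_neq0.
have kE1 s : I s ->
    derive1 (curvature rho (T \o gamma) (fun s => nu s *m A)) s = derive1 kappa s.
  by move=> Is; exact: (derive1_eq_on oI Is kE).
(* In the quotient of the two first coordinates the factor sg q / N cancels and 3 kappa / k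
   remains. *)
have E s : I s -> 3%:R * curvature rho (T \o gamma) (fun s => nu s *m A) s =
   k%:R * parallel_curvature (T \o gamma) (fun s => nu s *m A) s.
  move=> Is; rewrite kE// /parallel_curvature nE// /= xE// -/kappa.
  by field; rewrite kR sg0 !lt0r_neq0// q0.
exists T; split.
- by exists A, b; split.
- exact: (immersed_rotational oI ac' x0).
- by apply: (not_cmc_rot oI ac' cn' x0 Is0 _ E); rewrite kE1// dkap0.
- apply/(biconservative_rotP k oI ac' cn' x0) => s Is.
  by rewrite E// subrr mulr0.
Qed.

Theorem theorem3p3 (R : realType) (n : nat) (rho c : R) (I : set R)
    (gamma nu : R -> 'rV[R]_(1 + 2)) :
  (3 <= n)%N ->
  open I -> is_interval I -> I !=set0 ->
  arclength_curve rho c I gamma ->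
  curve_normal rho I gamma nu ->
  let kappa := curvature rho gamma nu in
  (forall s, I s -> 0 < kappa s) ->
  (forall s, I s -> derive1 kappa s != 0) ->
  let p : R := (n%:R - 2%:R) / (n%:R + 1) in
  let P := fun k : R => k `^ p in
  let M := fun g : R -> 'rV[R]_(1 + 2) => @rotational R (n - 2) I g in
  [/\ 4%:R^-1 <= p < 1,
      (immersed_hypersurface rho c (M gamma) -> ~ cmc rho (M gamma) ->
       biconservative rho (M gamma) ->
       forall s, I s -> euler_lagrange rho P kappa s) &
      ((forall s, I s -> euler_lagrange rho P kappa s) ->
       (rho < 0 -> forall s, I s -> 0 < first_integral rho P kappa s) ->
       exists T : 'rV[R]_(1 + 2) -> 'rV[R]_(1 + 2),
         [/\ space_form_isometry rho c T,
             immersed_hypersurface rho c (M (T \o gamma)),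
             ~ cmc rho (M (T \o gamma)) &
             biconservative rho (M (T \o gamma))])].
Proof.
move=> n3 oI iI I0 ac cn kappa kap0 dkap0 p P M.
have k0 : (0 < n - 2)%N by rewrite subn_gt0.
have n1 : 0 < n%:R + 1 :> R by rewrite addr_gt0// ltr0n (leq_trans _ n3).
have n3R : 3%:R <= n%:R :> R by rewrite ler_nat.
(* With k = n - 2, a genuine subtraction since n >= 3, the denominator n + 1 is k + 3. *)
have pE : p = (n - 2)%:R / ((n - 2)%:R + 3%:R).
  rewrite /p natrB ?(leq_trans _ n3)//; congr (_ / _).
  by rewrite -addrA; congr (_ + _); lra.
split.
- by rewrite /p ler_pdivlMr// ltr_pdivrMr//; apply/andP; split; lra.
- rewrite /P pE.
  exact: (biconservative_euler_lagrange k0 oI iI ac cn kap0 dkap0).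
- rewrite /P pE.
  exact: (euler_lagrange_biconservative k0 oI iI I0 ac cn kap0 dkap0).
Qed.
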